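(* Let $G$ and $H$ be nontrivial groups and let $\Gamma=G*H$ be their free product. For any nonempty finite set $A\subseteq\Gamma$, at least one of the following holds: (1) $A$ is conjugate into one of the factors, i.e. there is $\gamma\in\Gamma$ such that $\gamma A\gamma^{-1}\subseteq G$ or $\gamma A\gamma^{-1}\subseteq H$; (2) $|A^3|\ge \frac{1}{7776}|A|^2$; (3) the subgroup $\langle A\rangle$ generated by $A$ is infinite cyclic or infinite dihedral.
   Context: $A^3=\{a_1a_2a_3 : a_1,a_2,a_3\in A\}$ is the triple product set and $|\cdot|$ denotes cardinality. The groups $G,H$ are otherwise arbitrary. The infinite dihedral group is $C(2)*C(2)$, the free product of two groups of order 2. *)

(* Defs.v *)
From HB Require Import structures.
From mathcomp Require Import all_boot all_order all_algebra all_fingroup.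
From mathcomp Require Import finmap.
From mathcomp Require Import boolp classical_sets cardinality.

Set Implicit Arguments.
Unset Strict Implicit.
Unset Printing Implicit Defensive.

Local Open Scope classical_set_scope.
Local Open Scope group_scope.

(* The free product G * H, as the group of reduced words: a word is a list of
   letters in the disjoint union G + H, and it is reduced when no letter is
   trivial and consecutive letters come from different factors. *)
Section FreeProduct.
Variables G H : groupType.
Implicit Types (s t : G + H) (w : seq (G + H)).

Definition trivial_letter s : bool :=
  match s with inl g => g == 1 | inr h => h == 1 end.

Definition same_factor s t : bool :=
  match s, t with inl _, inl _ | inr _, inr _ => true | _, _ => false end.

Definition reduced w : bool :=
  all (predC trivial_letter) w && sorted (fun s t => ~~ same_factor s t) w.

Definition inv_letter s : G + H :=
  match s with inl g => inl g^-1 | inr h => inr h^-1 end.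

(* Left multiplication of a word by one letter, followed by reduction. *)
Definition cons_reduce s w : seq (G + H) :=
  if trivial_letter s then w else
  match s, w with
  | inl g, inl g' :: w' => if g * g' == 1 then w' else inl (g * g') :: w'
  | inr h, inr h' :: w' => if h * h' == 1 then w' else inr (h * h') :: w'
  | _, _ => s :: w
  end.

Definition word_mul w1 w2 : seq (G + H) := foldr cons_reduce w2 w1.
Definition word_inv w : seq (G + H) := rev (map inv_letter w).

Lemma reduced_cons s w :
  reduced (s :: w) =
  [&& ~~ trivial_letter s, (if w is t :: _ then ~~ same_factor s t else true)
    & reduced w].
Proof.
rewrite /reduced /=; case: w => [|t w] /=; first by rewrite !andbT.
by case: (trivial_letter s); case: (same_factor s t);
  rewrite ?andbT ?andbF.
Qed.

Lemma cons_reduce_reduced s w : reduced w -> reduced (cons_reduce s w).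
Proof.
rewrite /cons_reduce; case: ifPn => // s1.
case: w => [|t w] rw; first by case: s s1 => x x1; rewrite reduced_cons x1.
case: s s1 => x x1; case: t rw => y rw;
  try by rewrite reduced_cons rw andbT /= andbT.
all: move: rw; rewrite reduced_cons => /and3P[y1 yw rw]; case: ifPn => // xy1.
all: by rewrite reduced_cons /= xy1 rw; case: w yw {rw} => [|[]].
Qed.

Lemma word_mul_reduced w1 w2 : reduced w2 -> reduced (word_mul w1 w2).
Proof. by move=> rw2; elim: w1 => //= s w1; apply: cons_reduce_reduced. Qed.

Lemma cons_reduce_id s w : reduced (s :: w) -> cons_reduce s w = s :: w.
Proof.
rewrite reduced_cons /cons_reduce => /and3P[/negPf-> + _].
by case: s => x; case: w => [|[] y w].
Qed.

Lemma word_mul_nil w : reduced w -> word_mul w [::] = w.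
Proof.
elim: w => //= s w IHw rsw; rewrite IHw; first exact: cons_reduce_id.
by move: rsw; rewrite reduced_cons => /and3P[].
Qed.

Lemma cons_reducel (g g' : G) w : reduced w ->
  cons_reduce (inl g) (cons_reduce (inl g') w) = cons_reduce (inl (g * g')) w.
Proof.
rewrite /cons_reduce /=.
have [-> _|g1] := eqVneq g 1; first by rewrite mul1g.
have [->|g'1] := eqVneq g' 1; first by rewrite mulg1 (negPf g1).
case: w => [|[y|y] w] /=; rewrite ?reduced_cons /=.
- by case: (eqVneq (g * g') 1).
- case/and3P=> y1 yw rw; have [gy|gy] := eqVneq (g' * y) 1; last first.
    rewrite mulgA; have [gg|gg] := eqVneq (g * g') 1 => //.
    by rewrite gg mul1g (negPf y1).
  have -> : g * g' * y = g by rewrite -mulgA gy mulg1.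
  have [gg|gg] := eqVneq (g * g') 1.
    have <- : g = y by rewrite -[g]mulg1 -gy mulgA gg mul1g.
    by case: w yw {rw} => [|[z|z] w].
  by rewrite (negPf g1); case: w yw {rw} => [|[z|z] w].
- by case: (eqVneq (g * g') 1).
Qed.

Lemma cons_reducer (h h' : H) w : reduced w ->
  cons_reduce (inr h) (cons_reduce (inr h') w) = cons_reduce (inr (h * h')) w.
Proof.
rewrite /cons_reduce /=.
have [-> _|h1] := eqVneq h 1; first by rewrite mul1g.
have [->|h'1] := eqVneq h' 1; first by rewrite mulg1 (negPf h1).
case: w => [|[y|y] w] /=; rewrite ?reduced_cons /=.
- by case: (eqVneq (h * h') 1).
- by case: (eqVneq (h * h') 1).
- case/and3P=> y1 yw rw; have [hy|hy] := eqVneq (h' * y) 1; last first.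
    rewrite mulgA; have [hh|hh] := eqVneq (h * h') 1 => //.
    by rewrite hh mul1g (negPf y1).
  have -> : h * h' * y = h by rewrite -mulgA hy mulg1.
  have [hh|hh] := eqVneq (h * h') 1.
    have <- : h = y by rewrite -[h]mulg1 -hy mulgA hh mul1g.
    by case: w yw {rw} => [|[z|z] w].
  by rewrite (negPf h1); case: w yw {rw} => [|[z|z] w].
Qed.

Lemma word_mul_cons_reduce s w1 w2 : reduced w2 ->
  word_mul (cons_reduce s w1) w2 = cons_reduce s (word_mul w1 w2).
Proof.
move=> rw2; rewrite {1}/cons_reduce; case: ifPn => s1.
  by rewrite {1}/cons_reduce s1.
case: s s1 => [g|h] s1; case: w1 => [|[y|y] w1] //=;
  rewrite ?(cons_reducel, cons_reducer) ?word_mul_reduced //;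
  by case: ifPn => //= yy; rewrite /cons_reduce /= yy.
Qed.

Lemma word_mulA w1 w2 w3 : reduced w3 ->
  word_mul w1 (word_mul w2 w3) = word_mul (word_mul w1 w2) w3.
Proof.
by move=> rw3; elim: w1 => //= s w1 IHw; rewrite word_mul_cons_reduce ?IHw.
Qed.

Lemma inv_letterK : involutive inv_letter.
Proof. by case=> x /=; rewrite invgK. Qed.

Lemma word_invK : involutive word_inv.
Proof. by move=> w; rewrite /word_inv map_rev revK mapK //; exact: inv_letterK. Qed.

Lemma word_inv_reduced w : reduced w -> reduced (word_inv w).
Proof.
rewrite /reduced /word_inv all_rev all_map rev_sorted sorted_map.
case/andP=> w1 w2; apply/andP; split.
  by apply: sub_all w1 => -[] x /=; rewrite invg_eq1.
by apply: sub_sorted w2 => -[] x [].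
Qed.

Lemma cons_reduceV s w : reduced w ->
  cons_reduce s (cons_reduce (inv_letter s) w) = w.
Proof.
by case: s => x rw; rewrite /= ?(cons_reducel, cons_reducer) // mulgV
  /cons_reduce /= eqxx.
Qed.

Lemma word_mulVK w w' : reduced w' ->
  word_mul w (word_mul (word_inv w) w') = w'.
Proof.
elim: w w' => //= s w IHw w' rw'.
rewrite /word_inv /= rev_cons {2}/word_mul foldr_rcons.
have := IHw _ (cons_reduce_reduced (inv_letter s) rw').
by rewrite {2}/word_mul => ->; rewrite cons_reduceV.
Qed.

Lemma word_mulV w : reduced w -> word_mul w (word_inv w) = [::].
Proof.
move=> rw; rewrite -[X in word_mul w X]word_mul_nil ?word_inv_reduced //.
exact: word_mulVK.
Qed.

Record free_product : Type := FreeProduct {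
  fp_word :> seq (G + H);
  fp_wordP : reduced fp_word
}.

HB.instance Definition _ := [isSub for fp_word].
HB.instance Definition _ := [Choice of free_product by <:].

Implicit Types u v : free_product.

Definition fp_one : free_product := @FreeProduct [::] isT.
Definition fp_mul u v : free_product :=
  FreeProduct (word_mul_reduced u (fp_wordP v)).
Definition fp_inv u : free_product := FreeProduct (word_inv_reduced (fp_wordP u)).

Lemma fp_mulA : associative fp_mul.
Proof. by move=> u v w; apply/val_inj/word_mulA/fp_wordP. Qed.
Lemma fp_mul1 : left_id fp_one fp_mul.
Proof. by move=> u; apply/val_inj. Qed.
Lemma fp_mulr1 : right_id fp_one fp_mul.
Proof. by move=> u; apply/val_inj/word_mul_nil/fp_wordP. Qed.
Lemma fp_mulrV : right_inverse fp_one fp_inv fp_mul.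
Proof. by move=> u; apply/val_inj/word_mulV/fp_wordP. Qed.
Lemma fp_invK : involutive fp_inv.
Proof. by move=> u; apply/val_inj/word_invK. Qed.
Lemma fp_mulV : left_inverse fp_one fp_inv fp_mul.
Proof. by move=> u; rewrite -[X in fp_mul _ X]fp_invK fp_mulrV. Qed.

HB.instance Definition _ := isGroup.Build free_product
  fp_mulA fp_mul1 fp_mulr1 fp_mulV fp_mulrV.

Definition letter_word s : free_product :=
  FreeProduct (@cons_reduce_reduced s [::] isT).
Definition fp_inl (g : G) : free_product := letter_word (inl g).
Definition fp_inr (h : H) : free_product := letter_word (inr h).

Lemma fp_inl1 : fp_inl 1 = 1.
Proof. by apply/val_inj; rewrite /= /cons_reduce /= eqxx. Qed.
Lemma fp_inlM : {morph fp_inl : x y / x * y}.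
Proof.
move=> x y; apply/val_inj.
by rewrite /= word_mul_cons_reduce ?cons_reduce_reduced //= cons_reducel.
Qed.
Lemma fp_inr1 : fp_inr 1 = 1.
Proof. by apply/val_inj; rewrite /= /cons_reduce /= eqxx. Qed.
Lemma fp_inrM : {morph fp_inr : x y / x * y}.
Proof.
move=> x y; apply/val_inj.
by rewrite /= word_mul_cons_reduce ?cons_reduce_reduced //= cons_reducer.
Qed.

HB.instance Definition _ :=
  isUMagmaMorphism.Build G free_product fp_inl (fp_inl1, fp_inlM).
HB.instance Definition _ :=
  isUMagmaMorphism.Build H free_product fp_inr (fp_inr1, fp_inrM).

(* This section certifies the encoding: reduced words with fp_inl and fp_inr have
   the universal property of the free product. *)
Section Universal.
Variables (K : groupType) (f : UMagmaMorphism.type G K).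
Variable g : UMagmaMorphism.type H K.

Definition letter_eval s : K := match s with inl x => f x | inr y => g y end.
Definition fp_elim u : K := foldr (fun s k => letter_eval s * k) 1 u.

Lemma letter_eval1 s : trivial_letter s -> letter_eval s = 1.
Proof. by case: s => x /eqP-> /=; rewrite gmulf1. Qed.

Lemma eval_cons_reduce s w :
  foldr (fun s k => letter_eval s * k) 1 (cons_reduce s w) =
  letter_eval s * foldr (fun s k => letter_eval s * k) 1 w.
Proof.
rewrite /cons_reduce; case: ifPn => [s1|_].
  by rewrite letter_eval1 // mul1g.
case: s => x; case: w => [|[y|y] w] //=; case: eqP => [xy1|_] /=;
  by rewrite mulgA -gmulfM // xy1 gmulf1 mul1g.
Qed.

Lemma fp_elimM : {morph fp_elim : u v / u * v}.
Proof.
move=> u v; rewrite /fp_elim /= /word_mul.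
elim: (fp_word u) => [|s w IHw] /=; first by rewrite mul1g.
by rewrite eval_cons_reduce IHw mulgA.
Qed.

HB.instance Definition _ :=
  isUMagmaMorphism.Build free_product K fp_elim (erefl, fp_elimM).

Lemma fp_elim_inl x : fp_elim (fp_inl x) = f x.
Proof. by rewrite /fp_elim eval_cons_reduce /= mulg1. Qed.
Lemma fp_elim_inr y : fp_elim (fp_inr y) = g y.
Proof. by rewrite /fp_elim eval_cons_reduce /= mulg1. Qed.

Lemma fp_elim_uniq (phi : UMagmaMorphism.type free_product K) :
  phi \o fp_inl =1 f -> phi \o fp_inr =1 g -> phi =1 fp_elim.
Proof.
move=> phil phir [w rw]; elim: w rw => [|s w IHw] rsw.
  have -> : FreeProduct rsw = 1 by apply/val_inj.
  exact: gmulf1.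
have rw : reduced w by move: rsw; rewrite reduced_cons => /and3P[].
have -> : FreeProduct rsw = letter_word s * FreeProduct rw.
  apply/val_inj; rewrite /= word_mul_cons_reduce //=.
  by rewrite cons_reduce_id.
rewrite !gmulfM IHw; congr (_ * _).
case: s {rsw} => x.
  exact: etrans (phil x) (esym (fp_elim_inl x)).
exact: etrans (phir x) (esym (fp_elim_inr x)).
Qed.

End Universal.
End FreeProduct.

Section Subgroups.
Variable Gamma : groupType.
Implicit Type S : set Gamma.

Definition is_subgroup S : Prop :=
  [/\ S 1, forall x y, S x -> S y -> S (x * y) & forall x, S x -> S x^-1].

Definition generated_subgroup S : set Gamma := smallest is_subgroup S.

Definition infinite_cyclic S : Prop :=
  infinite_set S /\ exists t : Gamma, S = generated_subgroup [set t].

(* 'Z_2 is here the additive group Z/2, a group of order 2. *)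
Definition infinite_dihedral S : Prop :=
  exists f : UMagmaMorphism.type (free_product 'Z_2 'Z_2) Gamma,
    injective f /\ range f = S.

Definition fset_mul (A B : {fset Gamma}) : {fset Gamma} :=
  [fset a * b | a in A, b in B]%fset.

Definition triple_product (A : {fset Gamma}) : {fset Gamma} :=
  fset_mul (fset_mul A A) A.

End Subgroups.

(* Main.v *)
(* Conjugate [A] so that the total length of its reduced words is minimal. If a positive
   proportion [P] of [A] lies in a factor, then [P y P] has [|P|^2] elements for every
   [y] in [A] outside this factor, since factors are malnormal. Otherwise there are large
   [U], [X], [V] in [A], the words of [U] and [V] being no longer than those of [X], such
   that the products [u x v] are free of cancellation. If [u x v = u' x v'], then [u] and
   [u'] differ by a period of [x]; so if [|U x V|] is small compared with [|U| |V|], most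
   words of [U] end in a high power of the shortest period of [x]. Comparing two words
   [x], [x'] of [X] through a common end of words of [U], and through a common beginning
   of words of [V], their periods coincide, whence [X] lies in a single coset of an
   infinite cyclic group [C] that is the centralizer of each of its nontrivial elements.
   Finally either [x0 y] does not normalize [C] for some [x0] in [X] and [y] in [A], and
   then [X y X] has [|X|^2] elements, or [A] lies in the normalizer of [C], all of whose
   infinite subgroups are infinite cyclic or infinite dihedral. *)

From HB Require Import structures.
Require Import Defs.
From mathcomp Require Import all_boot all_order all_algebra all_fingroup.
From mathcomp Require Import finmap zify.
From mathcomp Require Import boolp classical_sets cardinality.

Set Implicit Arguments.
Unset Strict Implicit.
Unset Printing Implicit Defensive.

Local Open Scope nat_scope.

(** * Powers and periods of words *)

Section Words.
Variable T : eqType.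
Implicit Types s t u v w x y z : seq T.

(** Absence of cancellation does not make [u x v] a concatenation: at a junction two letters of one
    factor may merge, and the merged letter depends on both words. Different [x] can be compared
    through one set [U] only once the letters at the junctions are constant, and this has a price.
    Count in units of [|A|/88]. If [P] in [A] has at least one unit and [|P|^2 <= |A^3|], then
    [|A|^2 <= 7744 |A^3|], below the allowed 7776 = 6^5. The short words chosen make up at least
    seven units; fixing the factor of the last letter (for [U]) or of the first letter (for [V])
    keeps half of them, so [|U| |V| >= 49 |A|^2 / 176^2], which exceeds [12 |A^3|] when
    [|A|^2 > 7776 |A^3|]. Of these 12, 2 + 2 pay for constant end letters and 8 = 6 + 2 for
    comparing periods. Torsion in [G] and [H] does no harm to [C]: the period [w] occurs cubed in a
    reduced word, so [w w] is reduced and the powers of [w] do not collapse. *)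

Lemma prefix_comparable s t z : prefix s z -> prefix t z -> size s <= size t -> prefix s t.
Proof.
by rewrite !prefixE => /eqP sz /eqP tz le_st; rewrite -[X in take _ X]tz take_takel ?sz.
Qed.

Lemma prefix_size_inj s t z : prefix s z -> prefix t z -> size s = size t -> s = t.
Proof. by rewrite !prefixE => /eqP sz /eqP tz st; rewrite -sz st. Qed.

Lemma suffix_comparable s t z : suffix s z -> suffix t z -> size s <= size t -> suffix s t.
Proof.
by rewrite -!prefix_rev -(size_rev s) -(size_rev t); apply: prefix_comparable.
Qed.

Lemma suffix_size_inj s t z : suffix s z -> suffix t z -> size s = size t -> s = t.
Proof.
rewrite -!prefix_rev -(size_rev s) -(size_rev t) => sz tz st.
exact/(inv_inj revK)/(prefix_size_inj sz tz st).
Qed.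

Lemma prefix_cat2l s t z : prefix (s ++ t) (s ++ z) = prefix t z.
Proof. by elim: s => //= a s IHs; rewrite eqxx. Qed.

Lemma suffix_cat2r s t z : suffix (t ++ s) (z ++ s) = suffix t z.
Proof. by rewrite -!prefix_rev !rev_cat prefix_cat2l. Qed.

Lemma cat_injl s t z : s ++ t = s ++ z -> t = z.
Proof. by move/(congr1 (drop (size s))); rewrite !drop_size_cat. Qed.

Lemma cat_injr s t z : t ++ s = z ++ s -> t = z.
Proof. by move/(congr1 rev); rewrite !rev_cat => /cat_injl/(inv_inj revK). Qed.

Definition wpow w n := iter n (cat w) [::].

Lemma wpowS w n : wpow w n.+1 = w ++ wpow w n.
Proof. by []. Qed.

Lemma wpow1 w : wpow w 1 = w.
Proof. exact: cats0. Qed.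

Lemma wpowD w m n : wpow w (m + n) = wpow w m ++ wpow w n.
Proof. by elim: m => //= m IHm; rewrite IHm catA. Qed.

Lemma wpowSr w n : wpow w n.+1 = wpow w n ++ w.
Proof. by rewrite -addn1 wpowD wpow1. Qed.

Lemma size_wpow w n : size (wpow w n) = n * size w.
Proof. by elim: n => //= n IHn; rewrite size_cat IHn mulSn. Qed.

Lemma wpow_mul w m n : wpow (wpow w m) n = wpow w (m * n).
Proof. by elim: n => [|n IHn]; rewrite ?muln0 // mulnS wpowD -IHn. Qed.

Lemma suffix_wpow w m n : m <= n -> suffix (wpow w m) (wpow w n).
Proof. by move=> /subnK <-; rewrite wpowD suffix_suffix. Qed.

Lemma prefix_wpow w m n : m <= n -> prefix (wpow w m) (wpow w n).
Proof. by move=> /subnKC <-; rewrite wpowD prefix_prefix. Qed.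

Lemma wpow_comm y w n : y ++ w = w ++ y -> y ++ wpow w n = wpow w n ++ y.
Proof.
move=> yw; elim: n => [|n IHn]; first by rewrite cats0.
by rewrite wpowS catA yw -!catA IHn.
Qed.

(** Throughout, [prefix x (t ++ x)] encodes that [t] is a period of [x], possibly longer than [x].
    Iterating it makes [x] a prefix of [t^n x]. *)
Lemma period_prefix_wpow t x n :
  prefix x (t ++ x) -> size x <= n * size t -> prefix x (wpow t n).
Proof.
move=> xtx sx; have xn : prefix x (wpow t n ++ x).
  elim: n {sx} => [|n IHn]; first exact: prefix_refl.
  by apply: prefix_trans xtx _; rewrite wpowS -catA prefix_cat2l.
by apply: prefix_comparable xn (prefix_prefix _ _) _; rewrite size_wpow.
Qed.

Lemma comm_prefix_wpow y w n :
  y ++ w = w ++ y -> size y <= n * size w -> prefix y (wpow w n).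
Proof. by move=> yw; apply: period_prefix_wpow; rewrite -yw prefix_prefix. Qed.

(* Both [y ++ t] and [t ++ y] are prefixes of a long power of [t]. *)
Lemma comm_wpow y t j : 0 < j -> y ++ wpow t j = wpow t j ++ y -> y ++ t = t ++ y.
Proof.
case: t => [|a t] j0 yt; first by rewrite cats0.
set w := a :: t in yt *.
have pty m : size y <= m * size w -> prefix y (wpow w m).
  move=> sy; have yn : prefix y (wpow w (j * m)).
    rewrite -wpow_mul; apply: comm_prefix_wpow => //.
    by rewrite size_wpow mulnA (leq_trans sy) // leq_mul // -{1}[m]muln1 leq_mul.
  apply: prefix_comparable yn (prefix_wpow _ _) _; last by rewrite size_wpow.
  by rewrite leq_pmull.
have ym := pty (size y); rewrite leq_pmulr // in ym.
have {}ym := ym isT.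
apply: (@prefix_size_inj _ _ (wpow w (j + size y))); last first.
- by rewrite !size_cat addnC.
- apply: (@prefix_trans _ (wpow w (size y).+1)); first by rewrite wpowS prefix_cat2l.
  by apply: prefix_wpow; rewrite -add1n leq_add2r.
- apply: (@prefix_trans _ (y ++ wpow w j)).
    by rewrite prefix_cat2l -{1}[w]wpow1 prefix_wpow.
  by rewrite yt wpowD prefix_cat2l.
Qed.

(* The weak form of the Fine-Wilf theorem: [s ++ t] and [t ++ s] are prefixes of
   [s ++ x] and [t ++ x], both of which extend [x]. *)
Lemma periods_comm s t x : prefix x (s ++ x) -> prefix x (t ++ x) ->
  size s + size t <= size x -> s ++ t = t ++ s.
Proof.
move=> xs xt st.
have le_s : size s <= size x by rewrite (leq_trans _ st) ?leq_addr.
have le_t : size t <= size x by rewrite (leq_trans _ st) ?leq_addl.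
have sx : prefix s x by exact: prefix_comparable (prefix_prefix s x) xs le_s.
have tx : prefix t x by exact: prefix_comparable (prefix_prefix t x) xt le_t.
have stx : prefix (s ++ t) x.
  apply: (@prefix_comparable _ _ (s ++ x)) => //; first by rewrite prefix_cat2l.
  by rewrite size_cat.
have tsx : prefix (t ++ s) x.
  apply: (@prefix_comparable _ _ (t ++ x)) => //; first by rewrite prefix_cat2l.
  by rewrite size_cat addnC.
by apply: prefix_size_inj stx tsx _; rewrite !size_cat addnC.
Qed.

Definition min_period w x :=
  [/\ w != [::], prefix x (w ++ x)
    & forall t, t != [::] -> prefix x (t ++ x) -> size w <= size t].

Lemma min_period_exists (a : T) x : exists w, min_period w x.
Proof.
have [->|x0] := eqVneq x [::].
  by exists [:: a]; split => // -[].
pose P d := (0 < d) && prefix x (take d x ++ x).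
have exP : exists d, P d.
  by exists (size x); rewrite /P lt0n size_eq0 x0 take_size prefix_prefix.
have [d /andP[d0 xd] dmin] := ex_minnP exP.
have dx : d <= size x.
  by apply: dmin; rewrite /P lt0n size_eq0 x0 take_size prefix_prefix.
exists (take d x); split=> //; first by rewrite -size_eq0 size_takel // -lt0n.
move=> t t0 xt; rewrite size_takel //.
have [tx|xt'] := leqP (size t) (size x); last exact: leq_trans dx (ltnW xt').
apply: dmin; rewrite /P lt0n size_eq0 t0 /=.
by have := prefix_comparable (prefix_prefix t x) xt tx; rewrite prefixE => /eqP->.
Qed.

Lemma min_period_wpow w x t : min_period w x -> size t <= uphalf (size x) ->
  prefix x (t ++ x) -> exists j, t = wpow w j.
Proof.
move=> [w0 xw mw]; have [n] := ubnP (size t); elim: n t => // n IHn t /ltnSE-tn tx xt.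
have [->|t0] := eqVneq t [::]; first by exists 0.
have st : 0 < size t by rewrite lt0n size_eq0.
have wt := mw _ t0 xt.
have t_le : size t <= size x by rewrite (leq_trans tx) // leq_uphalf_double; lia.
have ptx : prefix t x by apply: prefix_comparable (prefix_prefix t x) xt t_le.
have pwx : prefix w x.
  by apply: prefix_comparable (prefix_prefix w x) xw (leq_trans wt t_le).
(* Unequal lengths give [|w| + |t| <= 2 uphalf |x| - 1 <= |x|], so rounding up is harmless for
   [periods_comm]; then one copy of [w] is removed from [t]. *)
have [ewt|nwt] := eqVneq (size w) (size t).
  by exists 1; rewrite wpow1; apply: prefix_size_inj ptx pwx _.
have cwt : w ++ t = t ++ w by apply: (periods_comm xw xt); lia.
have /prefixP[t' et] := prefix_comparable pwx ptx wt.
have sw : 0 < size w by rewrite lt0n size_eq0.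
have xt' : prefix x (t' ++ x).
  apply: (@prefix_comparable _ _ (t ++ x)) => //; last by rewrite size_cat leq_addl.
  have -> : t ++ x = t' ++ w ++ x.
    by rewrite catA; congr (_ ++ x); move: cwt; rewrite et -catA => /cat_injl.
  by rewrite prefix_cat2l.
move: (congr1 size et); rewrite size_cat => st'.
by have [||//|j ej] := IHn t'; [lia|lia|exists j.+1; rewrite et ej].
Qed.

(** [x] is a prefix of a power of [w], with which [w'] commutes, so [w'] is a period of [x] and
    minimality forces equal lengths. *)
Lemma min_period_comm w w' x : min_period w x -> w' != [::] ->
  size w' <= size w -> w ++ w' = w' ++ w -> w' = w.
Proof.
move=> [w0 xw mw] w'0 le_w' cww'.
have sw : 0 < size w by rewrite lt0n size_eq0.
pose m := size x; have xm : prefix x (wpow w m.+1).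
  by apply: period_prefix_wpow => //; rewrite /m mulSn (leq_trans (leq_pmulr _ sw)) ?leq_addl.
have w'x : prefix x (w' ++ x).
  apply: (@prefix_comparable _ _ (w' ++ wpow w m.+1)); last by rewrite size_cat leq_addl.
    by rewrite wpow_comm //; exact: prefix_catl.
  by rewrite prefix_cat2l.
have es : size w' = size w by apply/eqP; rewrite eqn_leq le_w' mw.
apply: (@prefix_size_inj _ _ (w ++ w')) => //; last exact: prefix_prefix.
by rewrite cww' prefix_prefix.
Qed.

(** Left and right periods correspond through [w x = x w'], which preserves lengths and hence
    minimality. *)
Lemma min_period_rev w x : min_period w x ->
  exists2 w', w ++ x = x ++ w' & min_period (rev w') (rev x).
Proof.
move=> [w0 xw mw]; have /prefixP[w' ew] := xw.
have es : size w' = size w by have := congr1 size ew; rewrite !size_cat; lia.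
exists w' => //; split.
- by rewrite -size_eq0 size_rev es size_eq0.
- by rewrite -rev_cat -ew rev_cat prefix_prefix.
move=> t t0; rewrite -[t]revK -rev_cat prefix_rev => /suffixP[t' et].
have est : size t' = size t.
  by have := congr1 size et; rewrite !size_cat !size_rev; lia.
rewrite size_rev revK es -est mw //; last by rewrite -et prefix_prefix.
by rewrite -size_eq0 est size_eq0.
Qed.

(** All trailing copies of [w] are removed; [p] holds the remaining word and the number of copies,
    called [k u] and [e u] below. *)
Lemma strip_exists w u : w != [::] -> exists p, u = p.1 ++ wpow w p.2 /\ ~~ suffix w p.1.
Proof.
move=> w0; have sw : 0 < size w by rewrite lt0n size_eq0.
have [n] := ubnP (size u); elim: n u => // n IHn u /ltnSE-un.
have [/suffixP[u' eu]|nwu] := boolP (suffix w u); last by exists (u, 0); rewrite cats0.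
have [|p [eu' np]] := IHn u'; first by move: un; rewrite eu size_cat; lia.
by exists (p.1, p.2.+1); rewrite wpowSr catA -eu'.
Qed.

Lemma strip_uniq w u1 u2 i j : ~~ suffix w u1 -> ~~ suffix w u2 ->
  u1 ++ wpow w i = u2 ++ wpow w j -> u1 = u2 /\ i = j.
Proof.
move=> n1 n2; elim: i j => [|i IHi] [|j].
- by rewrite !cats0.
- by rewrite cats0 wpowSr catA => e; rewrite e suffix_suffix in n1.
- by rewrite cats0 wpowSr catA => e; rewrite -e suffix_suffix in n2.
by rewrite !wpowSr !catA => /cat_injr/IHi[-> ->].
Qed.

End Words.

(** With one representative per value of [k], the pairs (class, [v]) inject into [Z]: equal products
    have equal classes, hence the same representative, hence the same [v]. *)
Lemma leq_size_classes (I J K M : eqType) (k : I -> K) (f : I -> J -> M)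
    (U : seq I) (V : seq J) (Z : seq M) :
  uniq V -> {in U & V, forall u v, f u v \in Z} ->
  {in U, forall u, {in V &, injective (f u)}} ->
  (forall u u' v v', u \in U -> u' \in U -> v \in V -> v' \in V ->
     f u v = f u' v' -> k u = k u') ->
  size (undup (map k U)) * size V <= size Z.
Proof.
case: U => [|u0 U']; first by [].
move: (u0 :: U') => U {U'} uV UVZ finj fk.
pose rep c := nth u0 U (index c (map k U)).
have repP c : c \in map k U -> rep c \in U /\ k (rep c) = c.
  move=> cU; have lt : index c (map k U) < size U by rewrite -(size_map k) index_mem.
  by split; [exact: mem_nth|rewrite -[k _](nth_map u0 c) // nth_index].
rewrite -(size_allpairs (fun c v => f (rep c) v)); apply: uniq_leq_size.
  apply: allpairs_uniq => [|//|[c v] [c' v']]; first exact: undup_uniq.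
  move=> /allpairsP[[c1 v1] /= [c1U v1V [-> ->]]] /allpairsP[[c2 v2] /= [c2U v2V [-> ->]]].
  rewrite !mem_undup in c1U c2U.
  have [r1 k1] := repP _ c1U; have [r2 k2] := repP _ c2U => ef.
  have ec : c1 = c2 by rewrite -k1 -k2; apply: fk ef.
  by rewrite ec in ef *; rewrite (finj _ r2 _ _ v1V v2V ef).
move=> _ /allpairsP[[c v] /= [cU vV ->]]; rewrite mem_undup in cU.
by apply: UVZ => //; have [] := repP _ cU.
Qed.

(** * Collisions in products [u x v] and common periods *)

Section Periods.
Variable T : eqType.
Implicit Types (s t u v w x y z : seq T) (U V X Z : seq (seq T)).

Section Strip.
Variables (w : seq T) (k : seq T -> seq T) (e : seq T -> nat).
Hypothesis kP : forall u, u = k u ++ wpow w (e u).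
Hypothesis kN : forall u, ~~ suffix w (k u).

Lemma strip_cat u j : k (u ++ wpow w j) = k u /\ e (u ++ wpow w j) = e u + j.
Proof.
by apply: (@strip_uniq _ w) => //; rewrite wpowD catA -!kP.
Qed.

Lemma strip_suffix u r : r <= e u -> suffix (wpow w r) u.
Proof. by move=> re; rewrite [u]kP suffix_catr // suffix_wpow. Qed.

(** [u] is recovered from [(k u, e u)], and [e u < r] unless [u] ends in [w^r]. Few classes
    therefore force most words to end in a high power of [w]. *)
Lemma size_not_suffix U r : uniq U ->
  size [seq u <- U | ~~ suffix (wpow w r) u] <= r * size (undup (map k U)).
Proof.
move=> uU; rewrite -[r in r * _](size_iota 0) mulnC -(size_allpairs pair).
rewrite -(size_map (fun u => (k u, e u))); apply: uniq_leq_size.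
  rewrite map_inj_uniq ?filter_uniq // => u u' [ku eu].
  by rewrite [u]kP [u']kP ku eu.
move=> c /mapP[u]; rewrite mem_filter => /andP[nu uU'] ->.
rewrite allpairs_f ?mem_undup ?map_f // mem_iota /= add0n ltnNge.
by apply: contra nu; apply: strip_suffix.
Qed.

(* If [u x v = u' x v'] with [u] shorter than [u'], then [x] occurs in this word at two
   places, so the difference of [u] and [u'] is a period of [x]. *)
Lemma strip_collision x u u' v v' : min_period w x ->
  size u <= size u' -> size u' <= size u + uphalf (size x) ->
  u ++ x ++ v = u' ++ x ++ v' -> k u = k u'.
Proof.
move=> mw le_u le_u' euv.
have /prefixP[t et] : prefix u u'.
  by apply: (@prefix_comparable _ _ _ (u ++ x ++ v)); rewrite ?prefix_prefix // euv prefix_prefix.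
have ext : x ++ v = t ++ x ++ v' by apply/(@cat_injl _ u); rewrite euv et -!catA.
have xt : prefix x (t ++ x).
  apply: (@prefix_comparable _ _ _ (x ++ v)); rewrite ?prefix_prefix //.
    by rewrite ext catA prefix_prefix.
  by rewrite size_cat leq_addl.
have [|j ej] := min_period_wpow mw _ xt.
  by move: le_u'; rewrite et size_cat leq_add2l.
by rewrite et ej (strip_cat u j).1.
Qed.

Lemma strip_count_window U V Z x m : min_period w x -> uniq V ->
  {in U, forall u, m <= size u <= m + uphalf (size x)} ->
  {in U & V, forall u v, u ++ x ++ v \in Z} ->
  size (undup (map k U)) * size V <= size Z.
Proof.
move=> mw uV szU UVZ; apply: (leq_size_classes (f := fun u v => u ++ x ++ v)) => //.
  by move=> u _ v v' _ _ /cat_injl/cat_injl.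
move=> u u' v v' uU u'U _ _ euv.
have := szU _ uU; have := szU _ u'U => s1 s2.
have [le_u|le_u] := leqP (size u) (size u').
  by apply: (strip_collision mw le_u _ euv); lia.
by apply/esym/(strip_collision mw (ltnW le_u) _ (esym euv)); lia.
Qed.

(** Collisions are understood only for lengths differing by at most [h = uphalf (size x)]. The
    lengths from [m] to [m + 2h + 1] form two such windows, whence the factor 2. *)
Lemma strip_count U V Z x m : min_period w x -> uniq V ->
  {in U, forall u, m <= size u <= m + (uphalf (size x)).*2.+1} ->
  {in U & V, forall u v, u ++ x ++ v \in Z} ->
  size (undup (map k U)) * size V <= 2 * size Z.
Proof.
move=> mw uV szU UVZ; set h := uphalf (size x) in szU.
pose P u := size u <= m + h.
have c1 : size (undup (map k (filter P U))) * size V <= size Z.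
  apply: (strip_count_window (m := m) mw uV) => [u|u v];
    rewrite mem_filter => /andP[Pu uU]; last exact: UVZ.
  by have := szU _ uU; rewrite /P -/h in Pu *; lia.
have c2 : size (undup (map k (filter (predC P) U))) * size V <= size Z.
  apply: (strip_count_window (m := m + h.+1) mw uV) => [u|u v];
    rewrite mem_filter => /andP[/= Pu uU]; last exact: UVZ.
  by have := szU _ uU; rewrite /P -/h in Pu *; lia.
have : size (undup (map k U)) <=
    size (undup (map k (filter P U)) ++ undup (map k (filter (predC P) U))).
  apply: uniq_leq_size; first exact: undup_uniq.
  move=> c; rewrite mem_undup => /mapP[u uU ->]; rewrite mem_cat !mem_undup.
  by apply/orP; case Pu: (P u); [left|right]; rewrite map_f // mem_filter /= Pu.
by rewrite size_cat => /leq_mul/(_ (leqnn (size V))); nia.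
Qed.

End Strip.

Lemma strip_functions w : w != [::] -> exists k (e : seq T -> nat),
  (forall u, u = k u ++ wpow w (e u)) /\ forall u, ~~ suffix w (k u).
Proof.
move=> w0; have [p pP] := choice (fun u => strip_exists u w0).
by exists (fun u => (p u).1), (fun u => (p u).2); split=> u; have [] := pP u.
Qed.

(** The letter is the last one of the shortest period of [x]: the words of [U] not ending in this
    period are no more numerous than the classes. *)
Lemma common_last_letter (a : T) U V Z x m : uniq U -> uniq V ->
  {in U, forall u, m <= size u <= m + (uphalf (size x)).*2.+1} ->
  {in U & V, forall u v, u ++ x ++ v \in Z} ->
  exists b : T, count [pred u | last a u != b] U * size V <= 2 * size Z.
Proof.
move=> uU uV szU UVZ; have [w mw] := min_period_exists a x.
have [w0 _ _] := mw; have [k [e [kP kN]]] := strip_functions w0.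
have := strip_count kP kN mw uV szU UVZ.
have := size_not_suffix kP 1 uU; rewrite mul1n wpow1 => c1 c2.
exists (last a w); apply: leq_trans c2; rewrite leq_mul2r; apply/orP; right.
apply: leq_trans c1; rewrite size_filter; apply: sub_count => u /=.
apply: contra => /suffixP[p ->]; rewrite last_cat.
by case: (w) w0.
Qed.

(** Let [s = w'^j]. If [s] is no longer than [w w], then [w s] and [s w] are both ends of [u s], so
    [w] commutes with [s] and hence with [w']. Otherwise [w w'] and [w' w] are both ends of
    [w'^(j+1)]. *)
Lemma suffix_cube_comm w w' u j : w' != [::] -> size w' <= size w -> 0 < j ->
  suffix (wpow w 3) u -> suffix (wpow w 3) (u ++ wpow w' j) -> w ++ w' = w' ++ w.
Proof.
move=> w'0 le_w' j0 wu; set s := wpow w' j => wus.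
have e3 : wpow w 3 = w ++ w ++ w by rewrite /wpow /= cats0.
have [le_s|lt_s] := leqP (size s) (size (w ++ w)).
  apply: (comm_wpow j0); rewrite -/s.
  have s2w : suffix s (w ++ w).
    have : suffix s (wpow w 3).
      by apply: suffix_comparable wus _; rewrite ?suffix_suffix // size_wpow;
         move: le_s; rewrite size_cat; lia.
    by move=> /suffix_comparable; apply => //; rewrite e3 suffix_suffix.
  have /suffixP[r er] := s2w.
  apply: (@suffix_size_inj _ _ _ (u ++ s)); last by rewrite !size_cat addnC.
    rewrite suffix_cat2r; apply: suffix_trans wu.
    by rewrite e3 catA suffix_suffix.
  by apply: suffix_trans wus; rewrite e3 catA er -catA suffix_suffix.
have wws : suffix (w ++ w) s.
  apply: (@suffix_comparable _ _ _ (u ++ s)); rewrite ?suffix_suffix ?(ltnW lt_s) //.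
  by apply: suffix_trans wus; rewrite e3 suffix_suffix.
have ws : suffix w s by apply: suffix_trans wws; apply: suffix_suffix.
have w's : suffix w' s by rewrite -[w' in suffix w' _]wpow1 suffix_wpow.
have /suffixP[r er] : suffix w' w by apply: suffix_comparable ws le_w'.
apply: (@suffix_size_inj _ _ _ (s ++ w')); last by rewrite !size_cat addnC.
  by rewrite suffix_cat2r.
rewrite -wpowSr wpowS; apply: suffix_catr; apply: suffix_trans wws.
by rewrite {2}er -catA suffix_suffix.
Qed.

(* By pigeonhole two words of [U] that end in [w ^ 3] differ by a power of [w'] on the
   right, and Fine-Wilf applied to that common end makes [w] and [w'] commute. *)
Lemma common_period U V Z w w' x x' : uniq U -> uniq V ->
  {in U, forall u, size u <= (uphalf (size x)).*2.+1} ->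
  {in U, forall u, size u <= (uphalf (size x')).*2.+1} ->
  {in U & V, forall u v, u ++ x ++ v \in Z} ->
  {in U & V, forall u v, u ++ x' ++ v \in Z} ->
  8 * size Z < size U * size V ->
  min_period w x -> min_period w' x' -> size w' <= size w -> w' = w.
Proof.
move=> uU uV szU szU' UVZ UVZ' big mw mw' le_w'.
have [w0 _ _] := mw; have [k [e [kP kN]]] := strip_functions w0.
have [w'0 _ _] := mw'; have [k' [e' [kP' kN']]] := strip_functions w'0.
have c1 : size (undup (map k U)) * size V <= 2 * size Z.
  by apply: (strip_count kP kN (m := 0) mw uV).
have c2 : size (undup (map k' U)) * size V <= 2 * size Z.
  by apply: (strip_count kP' kN' (m := 0) mw' uV).
have c3 := size_not_suffix kP 3 uU.
pose Q := [seq u <- U | suffix (wpow w 3) u].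
have szQ : size Q + size [seq u <- U | ~~ suffix (wpow w 3) u] = size U.
  by rewrite !size_filter count_predC.
(* After multiplication by [|V|], more than [8 |Z|] minus at most [6 |Z|] for words without the cube
   exceeds the [2 |Z|] available for classes of [k']. *)
have lt_Q : size (undup (map k' Q)) < size (map k' Q).
  have : size (undup (map k' Q)) <= size (undup (map k' U)).
    apply: uniq_leq_size; first exact: undup_uniq.
    move=> c; rewrite !mem_undup => /mapP[u]; rewrite mem_filter => /andP[_ uU'] ->.
    exact: map_f.
  rewrite size_map; nia.
have /negP/negP nuQ : ~~ uniq (map k' Q).
  by apply/negP => /undup_id eQ; rewrite eQ ltnn in lt_Q.
have [u [u' [uQ u'Q nuu' euu']]] : exists u u', [/\ u \in Q, u' \in Q, u != u' & k' u = k' u'].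
  apply: contrapT => nex; case/negP: nuQ; rewrite map_inj_in_uniq ?filter_uniq //.
  move=> u u' uQ u'Q euu'; apply/eqP; apply: contraT => nuu'.
  by case: nex; exists u, u'.
wlog lt_e : u u' uQ u'Q nuu' euu' / e' u < e' u'.
  move=> hw; have [lt|lt|ee] := ltngtP (e' u) (e' u').
  - exact: (hw u u').
  - by apply: (hw u' u) => //; rewrite eq_sym.
  by rewrite [u]kP' [u']kP' euu' ee eqxx in nuu'.
move: uQ u'Q; rewrite !mem_filter => /andP[su _] /andP[su' _].
apply: (min_period_comm mw) => //.
apply: (suffix_cube_comm (u := u) (j := e' u' - e' u)) => //; first by rewrite subn_gt0.
have <- : u' = u ++ wpow w' (e' u' - e' u); last by [].
by rewrite {1}[u']kP' {1}[u]kP' -catA -wpowD subnKC ?euu' // ltnW.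
Qed.

Lemma suffix_cube_exists U V Z w x : uniq U -> uniq V ->
  {in U, forall u, size u <= (uphalf (size x)).*2.+1} ->
  {in U & V, forall u v, u ++ x ++ v \in Z} ->
  8 * size Z < size U * size V -> min_period w x ->
  exists2 u, u \in U & suffix (wpow w 3) u.
Proof.
move=> uU uV szU UVZ big mw; have [w0 _ _] := mw.
have [k [e [kP kN]]] := strip_functions w0.
have c1 : size (undup (map k U)) * size V <= 2 * size Z.
  by apply: (strip_count kP kN (m := 0) mw uV).
have c3 := size_not_suffix kP 3 uU.
have /hasP : has (suffix (wpow w 3)) U; last by [].
rewrite has_count -[count _ _](addnK (count (predC (suffix (wpow w 3))) U)) count_predC.
rewrite subn_gt0 -size_filter ltnNge; apply/negP => /leq_trans/(_ c3).
by move=> /leq_mul/(_ (leqnn (size V))); nia.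
Qed.

End Periods.

(** [common_period] for [U] fixes the left period, and for the reversed [V] the right one. With both
    fixed, [w x = x w'] for all [x] in [X], so in a group each quotient [x' x^-1] commutes with
    [w]. *)
Lemma common_axis (T : eqType) (a : T) (U V X Z : seq (seq T)) x0 :
  uniq U -> uniq V -> x0 \in X -> [::] \notin X ->
  {in U & X, forall u x, size u <= (uphalf (size x)).*2.+1} ->
  {in V & X, forall v x, size v <= (uphalf (size x)).*2.+1} ->
  {in U & X & V, forall u x v, u ++ x ++ v \in Z} ->
  8 * size Z < size U * size V ->
  exists w w', [/\ w != [::], {in X, forall x, w ++ x = x ++ w'}
    & exists2 u, u \in U & suffix (wpow w 3) u].
Proof.
move=> uU uV x0X X0 szU szV UXVZ big.
have left_uniq x x' w w' : x \in X -> x' \in X -> min_period w x -> min_period w' x' -> w' = w.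
  move=> xX x'X mw mw'.
  have UVZ y : y \in X -> {in U & V, forall u v, u ++ y ++ v \in Z}.
    by move=> yX u v uU' vV; exact: UXVZ.
  have szU' y : y \in X -> {in U, forall u, size u <= (uphalf (size y)).*2.+1}.
    by move=> yX u uU'; exact: szU.
  have [le|/ltnW le] := leqP (size w') (size w).
    exact: (common_period uU uV (szU' _ xX) (szU' _ x'X) (UVZ _ xX) (UVZ _ x'X) big mw mw' le).
  apply/esym.
  exact: (common_period uU uV (szU' _ x'X) (szU' _ xX) (UVZ _ x'X) (UVZ _ xX) big mw' mw le).
have uU' : uniq (map rev U) by rewrite map_inj_uniq //; exact: inv_inj revK.
have uV' : uniq (map rev V) by rewrite map_inj_uniq //; exact: inv_inj revK.
have big' : 8 * size (map rev Z) < size (map rev V) * size (map rev U).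
  by rewrite !size_map mulnC [X in _ < X]mulnC mulnC.
have szV' x : x \in X -> {in map rev V, forall v, size v <= (uphalf (size (rev x))).*2.+1}.
  by move=> xX _ /mapP[v vV ->]; rewrite !size_rev szV.
have VXUZ x : x \in X -> {in map rev V & map rev U, forall v u, v ++ rev x ++ u \in map rev Z}.
  move=> xX _ _ /mapP[v vV ->] /mapP[u uU'' ->].
  by rewrite -!rev_cat map_f // -catA UXVZ.
have right_uniq x x' w w' : x \in X -> x' \in X ->
    min_period w (rev x) -> min_period w' (rev x') -> w' = w.
  move=> xX x'X mw mw'; have [le|/ltnW le] := leqP (size w') (size w).
    exact: (common_period uV' uU' (szV' _ xX) (szV' _ x'X) (VXUZ _ xX) (VXUZ _ x'X) big' mw mw' le).
  apply/esym.
  exact: (common_period uV' uU' (szV' _ x'X) (szV' _ xX) (VXUZ _ x'X) (VXUZ _ xX) big' mw' mw le).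
have [w mw] := min_period_exists a x0; have [w0 _ _] := mw.
have [w' ew mw'] := min_period_rev mw.
exists w, w'; split => // [x xX|]; last first.
  apply: (suffix_cube_exists uU uV _ _ big mw) => [u uU''|u v uU'' vV].
    exact: szU.
  exact: UXVZ.
have [v mv] := min_period_exists a x; have [v' ev mv'] := min_period_rev mv.
rewrite (left_uniq _ _ _ _ xX x0X mv mw) ev.
by rewrite (inv_inj revK (right_uniq _ _ _ _ xX x0X mv' mw')).
Qed.

(** * Products of reduced words *)

Section FreeProductWords.
Variables G H : groupType.
Notation letter := (G + H)%type.
Notation Gam := (free_product G H).
Implicit Types (s b c : letter) (u v w x y z : seq letter).

Lemma same_factorC s b : same_factor s b = same_factor b s.
Proof. by case: s; case: b. Qed.

Lemma same_factor_trans s b c : same_factor s b -> same_factor b c = same_factor s c.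
Proof. by case: s; case: b; case: c. Qed.

Lemma reduced_tail s w : reduced (s :: w) -> reduced w.
Proof. by rewrite reduced_cons => /and3P[]. Qed.

Lemma reduced_head s w : reduced (s :: w) -> ~~ trivial_letter s.
Proof. by rewrite reduced_cons => /and3P[]. Qed.

Lemma reduced_catr u v : reduced (u ++ v) -> reduced v.
Proof. by elim: u => //= s u IHu /reduced_tail/IHu. Qed.

Lemma reduced_catl u v : reduced (u ++ v) -> reduced u.
Proof.
elim: u => //= s u IHu; rewrite !reduced_cons => /and3P[-> h /IHu->].
by case: u h {IHu} => //= t u ->.
Qed.

Lemma reduced_glue u s s' v : reduced (rcons u s) -> same_factor s s' ->
  reduced (s' :: v) -> reduced (u ++ s' :: v).
Proof.
elim: u => //= t u IHu; rewrite reduced_cons => /and3P[t1 tu ru] ss' rv.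
rewrite reduced_cons t1 IHu //= andbT.
case: u tu {IHu ru} => [|t' u] //=.
by move=> /negPf tu; rewrite same_factorC (same_factor_trans _ ss') same_factorC tu.
Qed.

Lemma word_mul_cat u v : reduced (u ++ v) -> word_mul u v = u ++ v.
Proof.
elim: u => //= s u IHu rsuv; rewrite IHu ?(reduced_tail rsuv) //.
exact: cons_reduce_id.
Qed.

(** The value on letters of different factors is a dummy. *)
Definition letter_mul s b : letter :=
  match s, b with
  | inl g, inl g' => inl (g * g')%g
  | inr h, inr h' => inr (h * h')%g
  | _, _ => s
  end.

Definition join s b : seq letter :=
  if same_factor s b then [:: letter_mul s b] else [:: s; b].

Lemma trivial_letter_mul s b : same_factor s b ->
  trivial_letter (letter_mul s b) = (inv_letter s == b).
Proof.
by case: s; case: b => //= y x _; rewrite mulg_eq1 -eqg_invLR; apply/eqP/eqP => [->|[]].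
Qed.

Lemma cons_reduce_join s b z : ~~ trivial_letter s -> reduced (b :: z) ->
  inv_letter s != b -> cons_reduce s (b :: z) = join s b ++ z /\ reduced (join s b ++ z).
Proof.
move=> s1 rz nsb.
have e : cons_reduce s (b :: z) = join s b ++ z.
  rewrite /cons_reduce (negPf s1) /join; move: nsb.
  case: s s1 => x s1; case: b rz => y rz //= /negPf nsb.
    by have := @trivial_letter_mul (inl x) (inl y) isT; rewrite /= nsb => ->.
  by have := @trivial_letter_mul (inr x) (inr y) isT; rewrite /= nsb => ->.
by split; rewrite // -e cons_reduce_reduced.
Qed.

Lemma same_factor_mul s b : same_factor s b -> same_factor s (letter_mul s b).
Proof. by case: s; case: b. Qed.

Lemma word_mul_join u s b z : reduced (rcons u s) -> reduced (b :: z) ->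
  inv_letter s != b -> word_mul (rcons u s) (b :: z) = u ++ join s b ++ z.
Proof.
move=> ru rz nsb; have s1 : ~~ trivial_letter s.
  by apply: (@reduced_head _ [::]); apply: (@reduced_catr u); rewrite cats1.
have [e r] := cons_reduce_join s1 rz nsb.
rewrite /word_mul foldr_rcons e -/(word_mul _ _) word_mul_cat //.
move: r; rewrite /join; case: ifPn => sb r; first exact: reduced_glue ru (same_factor_mul sb) r.
by apply: reduced_glue ru _ r; case: (s).
Qed.

(** The middle word has two distinct ends [b] and [c], so the two junctions do not interact. *)
Lemma word_mul3_join u s b x c d v :
  reduced (rcons u s) -> reduced (b :: rcons x c) -> reduced (d :: v) ->
  inv_letter s != b -> inv_letter c != d ->
  word_mul (rcons u s) (word_mul (b :: rcons x c) (d :: v)) =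
    u ++ (join s b ++ x ++ join c d) ++ v.
Proof.
move=> ru rx rv nsb ncd; have e := @word_mul_join (b :: x) c d v rx rv ncd.
have r : reduced (b :: x ++ join c d ++ v).
  by have := word_mul_reduced (rcons (b :: x) c) rv; rewrite e.
by rewrite -rcons_cons e (word_mul_join ru r nsb) !catA.
Qed.

(** Defined on unreduced words as well, so that concatenation becomes multiplication and word
    identities turn into group identities. *)
Definition of_word w : Gam := FreeProduct (@word_mul_reduced G H w [::] isT).

Lemma of_wordK (u : Gam) : of_word u = u.
Proof. by apply/val_inj/word_mul_nil/fp_wordP. Qed.

Lemma of_word_val w : reduced w -> fp_word (of_word w) = w.
Proof. exact: word_mul_nil. Qed.

Lemma of_word_cat u v : of_word (u ++ v) = (of_word u * of_word v)%g.
Proof.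
apply/val_inj; rewrite /= {1}/word_mul foldr_cat -/(word_mul _ _) -/(word_mul _ _).
by rewrite -word_mulA ?word_mul_reduced.
Qed.
End FreeProductWords.

(** * Maximal cyclic subgroups *)

Section Isolated.
Variable Gam : groupType.
Local Open Scope group_scope.
Implicit Types (t z q c g : Gam) (m j k : nat).

(** Membership in the cyclic group of [t], an integer exponent being a difference of naturals. *)
Definition in_cyc t z := exists j k, z = t ^+ j * t ^- k.

Definition isolated t :=
  (forall m, 0 < m -> t ^+ m <> 1) /\
  (forall m z, 0 < m -> commute z (t ^+ m) -> in_cyc t z).

(** For [t] of infinite order this is the normalizer of its cyclic group, since the automorphisms of
    Z are the two signs. *)
Definition norm_cyc t q := t ^ q = t \/ t ^ q = t^-1.

Lemma in_cycX t j : in_cyc t (t ^+ j).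
Proof. by exists j, 0; rewrite divg1. Qed.

Lemma in_cycV t z : in_cyc t z -> in_cyc t z^-1.
Proof. by case=> j [k ->]; exists k, j; rewrite invgF. Qed.

Lemma in_cycM t z z' : in_cyc t z -> in_cyc t z' -> in_cyc t (z * z').
Proof.
case=> j [k ->] [j' [k' ->]]; exists (j + j'), (k' + k).
rewrite !expgnDr invgM !mulgA; congr (_ * _); rewrite -!mulgA; congr (_ * _).
exact/commute_sym/commuteV/commuteX2/commute_refl.
Qed.

Lemma in_cyc_commute t z : in_cyc t z -> commute z t.
Proof.
case=> j [k ->]; apply/commute_sym/commuteM.
  exact/commuteX/commute_refl.
exact/commuteV/commuteX/commute_refl.
Qed.

Lemma in_cycP t z : in_cyc t z -> exists m, z = t ^+ m \/ z = t ^- m.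
Proof.
case=> j [k ->]; have [kj|/ltnW jk] := leqP k j.
  by exists (j - k); left; rewrite expgnFr.
by exists (k - j); right; rewrite expgnFr // invgF.
Qed.

Lemma norm_cycM t q q' : norm_cyc t q -> norm_cyc t q' -> norm_cyc t (q * q').
Proof.
rewrite /norm_cyc => -[] eq [] eq'; rewrite conjgM eq ?conjVg eq' ?invgK.
- by left.
- by right.
- by right.
- by left.
Qed.

Lemma norm_cycV t q : norm_cyc t q -> norm_cyc t q^-1.
Proof.
rewrite /norm_cyc => -[] eq; [left|right].
  by rewrite -{1}eq conjgK.
by rewrite -[t in LHS]invgK -eq conjVg conjgK.
Qed.

Lemma isolated_conj t g : isolated t -> isolated (t ^ g).
Proof.
case=> tor cen; split=> [m m0|m z m0].
  by rewrite -conjXg => /eqP; rewrite conjg_eq1 => /eqP; apply: tor.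
rewrite -conjXg => com; have [|j [k e]] := cen m (z ^ g^-1) m0.
  by apply: (@conjg_inj _ g); rewrite /= conjMg [RHS]conjMg conjgKV.
by exists j, k; rewrite -[z](conjgKV g) e conjMg conjVg !conjXg.
Qed.

Section Fixed.
Variable t : Gam.
Hypothesis ti : isolated t.

Lemma isolated_commute z : commute z t -> in_cyc t z.
Proof. by have [_ /(_ 1%N)] := ti; apply. Qed.

Lemma isolated_inj j k : t ^+ j = t ^+ k -> j = k.
Proof.
have [tor _] := ti; wlog lejk : j k / j <= k.
  by move=> hw; have [/hw//|/ltnW/hw hkj /esym/hkj] := leqP j k.
move: lejk; rewrite leq_eqVlt => /predU1P[//|ltjk] e.
case: (tor (k - j)); first by rewrite subn_gt0.
by rewrite expgnFr ?(ltnW ltjk) // e mulgV.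
Qed.

(* Conjugation by [q] and by its inverse multiply exponents by integers with product 1. *)
Lemma norm_cyc_in_conj q : in_cyc t (t ^ q) -> in_cyc t (t ^ q^-1) -> norm_cyc t q.
Proof.
have [tor _] := ti.
move=> /in_cycP[a ea] /in_cycP[b eb].
have e : t = (t ^ q) ^ q^-1 by rewrite conjgK.
suff /eqP : (a * b)%N == 1%N.
  move=> /eqP; rewrite muln_eq1 => /andP[/eqP a1 _]; rewrite /norm_cyc a1 !expg1 in ea *.
  by case: ea; [left|right].
apply/eqP/isolated_inj; rewrite expg1 expgnA.
case: ea => ea; rewrite ea ?conjVg conjXg in e; case: eb => eb; rewrite eb in e.
- by rewrite {2}e expgnAC.
- case: (tor (b * a)%N.+1) => //.
  by rewrite expgS {1}e expVgn -expgnA mulVg.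
- case: (tor (b * a)%N.+1) => //.
  by rewrite expgS {1}e -expgnA mulVg.
- by rewrite {2}e expVgn invgK expgnAC.
Qed.

(** [t ^ q] commutes with [c ^ q], a nontrivial power of [t], so isolation applies. *)
Lemma in_cyc_conj c q : c <> 1 -> in_cyc t c -> in_cyc t (c ^ q) -> in_cyc t (t ^ q).
Proof.
have [_ cen] := ti; move=> c1 /in_cycP[m ec].
have m0 : 0 < m.
  by rewrite lt0n; apply/eqP => m0; apply: c1; case: ec => ->; rewrite m0 ?invg1.
have ct : commute (t ^ q) (c ^ q).
  rewrite /commute -!conjMg; congr (_ ^ _); case: ec => ->.
    exact/commuteX/commute_refl.
  exact/commuteV/commuteX/commute_refl.
have cq1 : c ^ q <> 1 by move/eqP; rewrite conjg_eq1 => /eqP.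
move=> /in_cycP[l ecl].
have l0 : 0 < l.
  by rewrite lt0n; apply/eqP => l0; apply: cq1; case: ecl => ->; rewrite l0 ?invg1.
apply: (cen l) => //; case: ecl => ecl; rewrite ecl in ct => //.
by rewrite -[t ^+ l]invgK; apply: commuteV.
Qed.

(** The substitute for malnormality: the cyclic group of [t] meets its conjugates by elements
    outside its normalizer trivially. *)
Lemma norm_cyc_conj c q : c <> 1 -> in_cyc t c -> in_cyc t (c ^ q) -> norm_cyc t q.
Proof.
move=> c1 ct cqt; apply: norm_cyc_in_conj; first exact: in_cyc_conj cqt.
apply: (@in_cyc_conj (c ^ q)) => //; last by rewrite conjgK.
by move/eqP; rewrite conjg_eq1 => /eqP.
Qed.

Lemma norm_cyc_square q : norm_cyc t q -> in_cyc t (q * q).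
Proof.
move=> nq; apply: isolated_commute; apply/commute_sym/commgP.
rewrite -conjg_fix conjgM; case: nq => e; rewrite !e // conjVg e invgK //.
Qed.

Lemma in_cyc_square c : in_cyc t c -> c * c = 1 -> c = 1.
Proof.
have [tor _] := ti; move=> /in_cycP[m ec] cc.
have [m0|m0] := posnP m; first by case: ec => ->; rewrite m0 ?invg1.
case: (tor (m + m)); first by rewrite addn_gt0 m0.
rewrite expgnDr; case: ec cc => -> //.
by rewrite -invgM => /eqP; rewrite invg_eq1 => /eqP.
Qed.
End Fixed.
End Isolated.

(** * Centralizers in free products *)

Section Roots.
Variables G H : groupType.
Notation letter := (G + H)%type.
Notation Gam := (free_product G H).
Implicit Types (s b c : letter) (u v w x y : seq letter) (z : Gam).

(** [t] is a shortest nonempty word commuting with [w]. Words commuting with [w] are prefixes of its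
    powers, so a nonempty one starts with [t]; removing [t] leaves a commuting word. *)
Lemma word_root (T : eqType) (w : seq T) : w != [::] ->
  exists (t : seq T) i, [/\ t != [::], 0 < i, w = wpow t i
    & forall y : seq T, y ++ w = w ++ y -> exists j, y = wpow t j].
Proof.
move=> w0; pose P n := `[< exists t : seq T, [/\ t != [::], t ++ w = w ++ t & size t = n] >].
have exP : exists n, P n by exists (size w); apply/asboolP; exists w.
have [n /asboolP[t [t0 tw st]] nmin] := ex_minnP exP.
have tP (y : seq T) : y ++ w = w ++ y -> exists j, y = wpow t j.
  have [k] := ubnP (size y); elim: k y => // k IHk y /ltnSE-yk yw.
  have [->|y0] := eqVneq y [::]; first by exists 0.
  have le_ty : size t <= size y by rewrite st nmin //; apply/asboolP; exists y.
  have sw : 0 < size w by rewrite lt0n size_eq0.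
  have pw (v : seq T) : v ++ w = w ++ v -> size v <= size y -> prefix v (wpow w (size y)).
    by move=> vw sv; apply: comm_prefix_wpow => //; apply: leq_trans sv (leq_pmulr _ sw).
  have /prefixP[y' ey] := prefix_comparable (pw _ tw le_ty) (pw _ yw (leqnn _)) le_ty.
  have st0 : 0 < size t by rewrite lt0n size_eq0.
  have [||j ej] := IHk y'.
  - by move: yk; rewrite ey size_cat; lia.
  - apply: (@cat_injl _ t); rewrite catA -ey yw ey !catA; congr (_ ++ _); exact/esym.
  by exists j.+1; rewrite ey ej.
have [i ew] := tP w erefl; exists t, i; split=> //.
by rewrite lt0n; apply/eqP => i0; rewrite ew i0 in w0.
Qed.

Lemma reduced_cat3 u v x : v != [::] ->
  reduced (u ++ v) -> reduced (v ++ x) -> reduced (u ++ v ++ x).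
Proof.
case/lastP: v => // v s _; rewrite -rcons_cat cat_rcons => ru rv.
by rewrite catA; apply: reduced_glue ru _ (reduced_catr rv); case: (s).
Qed.

Lemma reduced_wpow w n : reduced (w ++ w) -> reduced (wpow w n).
Proof.
have [->|w0 rw] := eqVneq w [::]; first by elim: n.
elim: n => // -[_|n IHn]; first by rewrite wpow1 (reduced_catr rw).
by rewrite !wpowS; apply: reduced_cat3.
Qed.

Lemma of_word_wpow w n : of_word (wpow w n) = (of_word w ^+ n)%g.
Proof.
elim: n => [|n IHn]; first exact/val_inj.
by rewrite wpowS of_word_cat IHn expgS.
Qed.

Lemma cons_reduce_drop s w : exists p k, k <= 1 /\ cons_reduce s w = p ++ drop k w.
Proof.
rewrite /cons_reduce; case: ifP => _; first by exists [::], 0; rewrite drop0.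
case: s => x; case: w => [|[y|y] w]; try by [exists [:: inl x], 0; rewrite ?drop0|
  exists [:: inr x], 0; rewrite ?drop0].
  case: ifP => _; first by exists [::], 1; rewrite /= drop0.
  by exists [:: inl (x * y)%g], 1; rewrite /= drop0.
case: ifP => _; first by exists [::], 1; rewrite /= drop0.
by exists [:: inr (x * y)%g], 1; rewrite /= drop0.
Qed.

(** Each letter of [u] consumes or alters at most one letter of [v]. *)
Lemma word_mul_drop u v : exists p k, k <= size u /\ word_mul u v = p ++ drop k v.
Proof.
elim: u => [|s u [p [k [ku e]]]] /=; first by exists [::], 0; rewrite drop0.
rewrite -/(word_mul u v) e.
have [p' [k' [k'1 ->]]] := cons_reduce_drop s (p ++ drop k v).
case: p {e} => [|b p] /=.
  by exists p', (k' + k); split; [lia|rewrite drop_drop].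
exists (p' ++ drop k' (b :: p)), k; split; first exact: leqW.
by rewrite -catA; case: k' k'1 => [|[|]] //= _; rewrite !drop0.
Qed.

(** [z] affects at most [size z] letters at the front, so the last of [size z + 1] copies of [w]
    survives. *)
Lemma suffix_mul_power z w : w != [::] -> reduced (w ++ w) ->
  suffix w (fp_word (z * of_word w ^+ (size z).+1)%g).
Proof.
move=> w0 rw; rewrite -of_word_wpow /= -wpowS word_mul_nil ?reduced_wpow //.
have [p [k [kz ->]]] := word_mul_drop z (wpow w (size z).+1).
have sw : 0 < size w by rewrite lt0n size_eq0.
have le : k <= size (wpow w (size z)) by rewrite size_wpow (leq_trans kz) ?leq_pmulr.
apply: suffix_catr; rewrite wpowSr drop_cat ltn_neqAle le andbT.
case: eqVneq => [->|_] /=; last exact: suffix_suffix.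
by rewrite subnn drop0 suffix_refl.
Qed.

Lemma of_word_inv w : of_word (word_inv w) = (of_word w)^-1%g.
Proof.
apply/esym/mulg1_eq; rewrite -of_word_cat; apply/val_inj => /=.
by rewrite /word_mul foldr_cat -/(word_mul _ _) word_mulVK.
Qed.

Lemma word_inv_cat u v : word_inv (u ++ v) = word_inv v ++ word_inv u.
Proof. by rewrite /word_inv map_cat rev_cat. Qed.

Lemma word_inv0 u : (word_inv u == [::]) = (u == [::]).
Proof. by rewrite -!size_eq0 size_rev size_map. Qed.

Lemma suffix_word_inv u v : suffix (word_inv u) (word_inv v) -> prefix u v.
Proof.
move=> /suffixP[p e]; apply/prefixP; exists (word_inv p).
by rewrite -[v]word_invK e word_inv_cat word_invK.
Qed.

(* Multiplying [z] by a large power of [w] makes it begin and end with [w], so that both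
   products with [w] are reduced as written. *)
Lemma commute_word z w : w != [::] -> reduced (w ++ w) -> commute z (of_word w) ->
  exists k, let y := fp_word (z * of_word w ^+ k)%g in y ++ w = w ++ y.
Proof.
move=> w0 rw zw; have rw1 := reduced_catr rw; exists (size z).+1.
set Y := (z * _)%g; move=> y.
have sy : suffix w y by exact: suffix_mul_power.
have py : prefix w y.
  apply: suffix_word_inv; have -> : word_inv y = fp_word Y^-1%g by [].
  rewrite /Y invgM -expVgn -of_word_inv.
  have -> : (size z).+1 = (size z^-1%g).+1 by rewrite /= size_rev size_map.
  rewrite (_ : (_ * _)%g = (z^-1 * of_word (word_inv w) ^+ (size z^-1%g).+1)%g).
    by apply: suffix_mul_power; rewrite ?word_inv0 // -word_inv_cat word_inv_reduced.
  apply/commute_sym/commuteX; rewrite of_word_inv.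
  by apply/commuteV/commute_sym/commuteV/commute_sym.
have ry : reduced y by exact: fp_wordP.
have ryw : reduced (y ++ w).
  by case/suffixP: sy => p ep; rewrite ep -catA reduced_cat3 // -ep.
have rwy : reduced (w ++ y).
  by case/prefixP: py => p ep; rewrite ep reduced_cat3 // -ep.
have com : (Y * of_word w = of_word w * Y)%g.
  apply/commute_sym/commuteM; first exact/commute_sym.
  exact/commuteX/commute_refl.
have : word_mul y (of_word w) = word_mul (of_word w) y := congr1 (@fp_word G H) com.
by rewrite of_word_val // !word_mul_cat.
Qed.

(** The root of [w] as a word serves in the group. Its powers are reduced, so its order is infinite;
    and if [z] commutes with [t^m], then by [commute_word] some [z t^(mk)] commutes with [t^m] as a
    word, hence with [t] and [w], and is a power of [t]. *)
Lemma isolated_root w : w != [::] -> reduced (w ++ w) ->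
  exists t i, [/\ isolated t, 0 < i & of_word w = (t ^+ i)%g :> Gam].
Proof.
move=> w0 rw; have [t [i [t0 i0 ew tP]]] := word_root w0.
have rt : reduced (t ++ t).
  have : prefix (t ++ t) (w ++ w).
    have -> : t ++ t = wpow t 2 by rewrite /wpow /= cats0.
    by rewrite ew -wpowD prefix_wpow //; lia.
  by case/prefixP=> p e; move: rw; rewrite e => /reduced_catl.
exists (of_word t), i; split=> //; last by rewrite ew of_word_wpow.
split=> [m m0 e|m z m0].
  have := congr1 (@fp_word G H) e; rewrite -of_word_wpow of_word_val ?reduced_wpow //.
  by move/(congr1 size)/eqP; rewrite size_wpow muln_eq0 size_eq0 (negPf t0) orbF; case: m m0 {e}.
rewrite -of_word_wpow => com.
have v0 : wpow t m != [::] by rewrite -size_eq0 size_wpow muln_eq0 size_eq0 negb_or -lt0n m0.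
have rv : reduced (wpow t m ++ wpow t m) by rewrite -wpowD reduced_wpow.
have [k ey] := commute_word v0 rv com.
have {}ey := comm_wpow m0 ey.
have [j ej] : exists j, fp_word (z * of_word (wpow t m) ^+ k)%g = wpow t j.
  by apply: tP; rewrite ew; apply: wpow_comm.
exists j, (m * k); rewrite -[(of_word t ^+ j)%g]of_word_wpow -ej of_wordK.
by rewrite of_word_wpow -expgnA mulgK.
Qed.
End Roots.

(** * Infinite cyclic and infinite dihedral subgroups *)

Section Dihedral.
Variables (Gam : groupType) (r s : Gam).
Local Open Scope group_scope.
Hypothesis ss1 : s * s = 1.

(** In [i == 1] the [1] is the group identity, the class of 0. *)
Definition involution_map (i : 'Z_2) : Gam := if i == 1 then 1 else s.

Lemma involution_mapM : {morph involution_map : x y / x * y}.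
Proof.
move=> [[|[|//]] x] [[|[|//]] y]; rewrite /involution_map -!val_eqE /= ?mul1g ?mulg1 //.
Qed.

Definition involution_morphism : UMagmaMorphism.type 'Z_2 Gam :=
  HB.pack involution_map
    (isUMagmaMorphism.Build 'Z_2 Gam involution_map (erefl, involution_mapM)).
End Dihedral.

Section Classification.
Variable Gam : groupType.
Local Open Scope group_scope.
Local Open Scope classical_set_scope.
Implicit Types (r s t z c : Gam) (S : set Gam).

Lemma subgroupX S z n : is_subgroup S -> S z -> S (z ^+ n).
Proof.
case=> S1 SM _ Sz; elim: n => [|n IHn]; first by rewrite expg0.
by rewrite expgS; apply: SM.
Qed.

Lemma subgroup_in_cyc S r z : is_subgroup S -> S r -> in_cyc r z -> S z.
Proof.
move=> sS Sr [j [k ->]]; have [_ SM SV] := sS.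
by apply: SM; [|apply: SV]; apply: subgroupX.
Qed.

Lemma generated_is_subgroup (B : set Gam) : is_subgroup (generated_subgroup B).
Proof.
split=> [|x y Gx Gy|x Gx] D DP; have [[D1 DM DV] BD] := DP => //.
  by apply: DM; [apply: Gx|apply: Gy].
by apply: DV; apply: Gx.
Qed.

Section DihedralGroup.
Variables r s : Gam.
Hypothesis ss1 : s * s = 1.
Hypothesis rs : r ^ s = r^-1.
Hypothesis r_free : forall m, (0 < m)%N -> r ^+ m <> 1.

Let sr1 : s * r * (s * r) = 1.
Proof.
have sV : s^-1 = s by exact: mulg1_eq.
move: rs; rewrite conjgE sV => e.
by rewrite -mulgA [r * _]mulgA mulgA mulgA -[s * r * s]mulgA e mulVg.
Qed.

Let srX n : s * r ^+ n = r ^- n * s.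
Proof.
have sV : s^-1 = s by exact: mulg1_eq.
have e : (r ^+ n) ^ s = r ^- n by rewrite conjXg rs expVgn.
by rewrite -e conjgE sV !mulgA -[_ * s * s]mulgA ss1 mulg1.
Qed.

Let srV n : s * r ^- n = r ^+ n * s.
Proof.
by apply: (@mulgI _ (r ^- n)); rewrite mulKg mulgA -srX -mulgA mulgV mulg1.
Qed.

Definition dihedral_map : UMagmaMorphism.type (free_product 'Z_2 'Z_2) Gam :=
  fp_elim (involution_morphism ss1) (involution_morphism sr1).

Let eval := foldr
  (fun l k => letter_eval (involution_morphism ss1) (involution_morphism sr1) l * k) 1.

Let side (w : seq ('Z_2 + 'Z_2)) := if w is inr _ :: _ then true else false.

(** A reduced word alternates between [s] and [s r], and its pairs are [s (s r) = r] or
    [(s r) s = r^-1] according to the first letter. The [uphalf] comes from [s r = r^-1 s]. *)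
Lemma dihedral_eval w : reduced w ->
  eval w = (if side w then r ^- (uphalf (size w)) else r ^+ (size w)./2) * s ^+ odd (size w).
Proof.
elim: w => [|l w IHw]; first by rewrite /= mulg1.
have evalE x : x != 1 -> (involution_map s x = s) * (involution_map (s * r) x = s * r).
  by rewrite /involution_map => /negPf->.
move=> rw; have /reduced_head l1 := rw; rewrite /= IHw ?(reduced_tail rw) //.
have sX : s * s ^+ odd (size w) = s ^+ (~~ odd (size w)).
  by case: odd; rewrite /= ?mulg1 // expg1 ss1.
have [ew|w0] := eqVneq w [::].
  by rewrite ew /=; case: l l1 {rw} => x x1 /=; rewrite evalE //= expg1 ?mulg1 ?mul1g //;
     have := srX 1; rewrite expg1.
case: l rw l1 => x; rewrite reduced_cons => /and3P[_ nw _] /= x1; rewrite evalE //.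
  have -> : side w = true by case: (w) w0 nw => // -[].
  by rewrite mulgA srV -mulgA sX.
have -> : side w = false by case: (w) w0 nw => // -[].
by rewrite mulgA -[s * r * _]mulgA -expgS srX -mulgA sX.
Qed.

Let s_not_cyc : ~ in_cyc r s.
Proof.
move=> /in_cyc_commute/commute_sym/commgP; rewrite -conjg_fix rs => /eqP rV.
by apply: (r_free (m := 2)) => //; rewrite expg2 -{1}rV mulVg.
Qed.

(** An odd word in the kernel would put [s] into the cyclic group of [r]; a nonempty even one would
    give [r] finite order. *)
Lemma dihedral_map_inj : injective dihedral_map.
Proof.
apply: gmulf_inj => u e; have {e} : eval u = 1 := e.
rewrite (dihedral_eval (fp_wordP u)) => e; apply/val_inj/eqP; rewrite -size_eq0 /=; move: e.
case: (odd _) (odd_double_half (size u)) => eo.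
  rewrite expg1 => /eqP; rewrite mulg_eq1 => e; case: s_not_cyc; rewrite -[s]invgK.
  by apply: in_cycV; rewrite -(eqP e); case: ifP => _; [apply: in_cycV|]; apply: in_cycX.
rewrite mulg1 uphalf_half -eo => e; apply/eqP; case en : (size u)./2 => [|n] //.
have : r ^+ n.+1 <> 1 by exact: r_free.
have o : odd (size u) = false by rewrite -eo add0n odd_double.
move: e; rewrite eo o add0n en; case: ifP => // _.
by move=> /eqP; rewrite invg_eq1 => /eqP.
Qed.

Lemma infinite_dihedralP S : is_subgroup S -> S r -> S s ->
  (forall z, S z -> in_cyc r z \/ in_cyc r (z * s)) -> infinite_dihedral S.
Proof.
move=> sS Sr Ss SP; have [S1 SM SV] := sS.
exists dihedral_map; split; first exact: dihedral_map_inj.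
apply/seteqP; split=> [_ [u _ <-]|z Sz].
  change (S (eval u)); elim: (fp_word u) => //= l w IHw.
  apply: (SM) => //; case: l => x; rewrite /= /involution_map; case: ifP => // _.
  exact: SM.
pose a : 'Z_2 := inZp 1; have a1 : (a == 1) = false by [].
have fs : dihedral_map (fp_inl _ a) = s.
  by rewrite /dihedral_map /= fp_elim_inl /= /involution_map a1.
have fsr : dihedral_map (fp_inr _ a) = s * r.
  by rewrite /dihedral_map /= fp_elim_inr /= /involution_map a1.
have fr : dihedral_map (fp_inl _ a * fp_inr _ a) = r.
  by rewrite gmulfM fs fsr mulgA ss1 mul1g.
have cyc y : in_cyc r y -> exists v, dihedral_map v = y.
  case=> j [k ->]; exists ((fp_inl _ a * fp_inr _ a) ^+ j * (fp_inl _ a * fp_inr _ a) ^- k).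
  by rewrite gmulfM gmulfXVn gmulfXn fr.
case: (SP _ Sz) => /cyc[v ev]; first by exists v.
exists (v * fp_inl _ a) => //.
by rewrite gmulfM ev fs -mulgA ss1 mulg1.
Qed.
End DihedralGroup.

Lemma infinite_cyclicP r S : (forall m, (0 < m)%N -> r ^+ m <> 1) ->
  is_subgroup S -> S r -> (forall z, S z -> in_cyc r z) -> infinite_cyclic S.
Proof.
move=> r_free sS Sr SP; split; last first.
  exists r; apply/seteqP; split=> [z Sz|].
    apply: subgroup_in_cyc (generated_is_subgroup _) _ (SP _ Sz).
    by apply: sub_gen_smallest.
  by apply: smallest_sub => // _ ->.
have rX_inj j k : r ^+ j = r ^+ k -> j = k.
  wlog lejk : j k / (j <= k)%N.
    by move=> hw; have [/hw//|/ltnW/hw hkj /esym/hkj] := leqP j k.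
  move: lejk; rewrite leq_eqVlt => /predU1P[//|ltjk] e.
  case: (r_free (k - j)%N); first by rewrite subn_gt0.
  by rewrite expgnFr ?(ltnW ltjk) // e mulgV.
move=> finS; apply: infinite_nat.
have -> : setT = (fun n => r ^+ n) @^-1` S.
  by apply/seteqP; split=> n // _; apply: subgroupX.
by apply: finite_preimage => // j k _ _ /rX_inj.
Qed.

(** [S] meets the cyclic group of [t] in the powers of [t^m], with [m] minimal. An [s] in [S]
    outside that group inverts [t], and [s s] is a power of [t] both fixed and inverted by [s],
    hence trivial. *)
Lemma cyclic_or_dihedral t S c : isolated t -> is_subgroup S ->
  (forall z, S z -> norm_cyc t z) -> S c -> c <> 1 -> in_cyc t c ->
  infinite_cyclic S \/ infinite_dihedral S.
Proof.
move=> ti sS SN Sc c1 ct; have [S1 SM SV] := sS; have [t_free _] := ti.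
pose P m := `[< (0 < m)%N /\ S (t ^+ m) >].
have exP : exists m, P m.
  have [m ec] := in_cycP ct; exists m; apply/asboolP; split.
    by rewrite lt0n; apply/eqP => m0; apply: c1; case: ec => ->; rewrite m0 ?invg1.
  by case: ec => ec; [rewrite -ec|rewrite -[t ^+ m]invgK -ec; apply: SV].
have [m /asboolP[m0 Stm] mmin] := ex_minnP exP.
have Scyc l : S (t ^+ l) -> in_cyc (t ^+ m) (t ^+ l).
  move=> Sl; have [e|] := posnP (l %% m).
    by rewrite (divn_eq l m) e addn0 mulnC expgnA; apply: in_cycX.
  move=> lm; have /mmin : P (l %% m)%N.
    apply/asboolP; split=> //.
    have -> : (t ^+ (l %% m)) = (t ^+ m) ^- (l %/ m) * t ^+ l.
      by rewrite {3}(divn_eq l m) mulnC expgnDr expgnA mulKg.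
    by apply: SM => //; apply: SV; apply: subgroupX.
  by rewrite leqNgt ltn_pmod.
have SScyc z : S z -> in_cyc t z -> in_cyc (t ^+ m) z.
  move=> Sz /in_cycP[l []] ez; first by rewrite ez; apply: Scyc; rewrite -ez.
  rewrite ez; apply/in_cycV/Scyc; rewrite -[t ^+ l]invgK -ez; exact: SV.
have r_free k : (0 < k)%N -> (t ^+ m) ^+ k <> 1.
  by move=> k0; rewrite -expgnA; apply: t_free; rewrite muln_gt0 m0.
have [allc|/existsNP[s /not_implyP[Ss ns]]] := pselect (forall z, S z -> in_cyc t z).
  left; apply: (infinite_cyclicP r_free) => // z Sz.
  by apply: SScyc => //; apply: allc.
have fixed z : t ^ z = t -> in_cyc t z.
  move=> e; apply: (isolated_commute ti); apply/commute_sym/commgP.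
  by rewrite -conjg_fix e.
have ts : t ^ s = t^-1 by case: (SN _ Ss) => // /fixed.
have ss1 : s * s = 1.
  have c2 := norm_cyc_square ti (SN _ Ss); apply: (in_cyc_square ti c2).
  have [n en] := in_cycP c2.
  have e : (s * s) ^ s = s * s by rewrite conjgE -mulgA mulKg.
  have : (s * s) ^ s = (s * s)^-1.
    by case: en => ->; rewrite ?conjVg conjXg ts expVgn.
  by rewrite e => {1}->; rewrite mulVg.
right; apply: (infinite_dihedralP ss1 _ r_free sS Stm Ss); first by rewrite conjXg ts expVgn.
move=> z Sz; case: (SN _ Sz) => tz; [left|right].
  by apply: SScyc => //; apply: fixed.
apply: SScyc; first exact: SM.
by apply: fixed; rewrite conjgM tz conjVg ts invgK.
Qed.

Lemma generated_norm_cyc t (B : set Gam) : isolated t ->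
  (forall z, B z -> norm_cyc t z) -> forall z, generated_subgroup B z -> norm_cyc t z.
Proof.
move=> ti BN; apply: smallest_sub => //; split=> [|x y|x].
- by left; rewrite conjg1.
- exact: norm_cycM.
- exact: norm_cycV.
Qed.

End Classification.

(** * Lower bounds for triple products *)

Section TripleProducts.
Variable Gam : groupType.
Local Open Scope group_scope.
Local Open Scope classical_set_scope.
Implicit Types (A : {fset Gam}) (P : seq Gam) (t y p q : Gam).

Lemma mem_triple_product A x y z :
  x \in A -> y \in A -> z \in A -> x * y * z \in triple_product A.
Proof.
move=> xA yA zA; apply/imfset2P; exists (x * y); last by exists z.
by apply/imfset2P; exists x => //; exists y.
Qed.

Lemma leq_square_triple_product A P y : uniq P -> {subset P <= A} -> y \in A ->
  {in P & P, forall p p', {in P & P, forall q q', p * y * q = p' * y * q' -> p = p'}} ->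
  (size P ^ 2 <= #|` triple_product A|)%N.
Proof.
move=> uP PA yA inj; rewrite -mulnn -(size_allpairs (fun p q => p * y * q)).
apply: uniq_leq_size => [|z /allpairsP[[p q] /= [pP qP ->]]].
  apply: allpairs_uniq => // -[p q] [p' q'].
  move=> /allpairsP[[p1 q1] /= [p1P q1P [-> ->]]] /allpairsP[[p2 q2] /= [p2P q2P [-> ->]]] e.
  have ep := inj _ _ p1P p2P _ _ q1P q2P e.
  by move: e; rewrite ep => /mulgI->.
by apply: mem_triple_product => //; apply: PA.
Qed.

(** If every [p0 y] with [y] in [A] normalizes [C], then so do [p0 p1] and [p0 p0]; this is used to
    put [p0], and with it all of [A], into the normalizer. *)
Lemma axis_dichotomy A P t : isolated t -> uniq P -> {subset P <= A} -> (1 < size P)%N ->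
  {in P & P, forall p q, in_cyc t (q * p^-1)} ->
  (size P ^ 2 <= #|` triple_product A|)%N \/
  (infinite_cyclic (generated_subgroup [set` A]) \/
   infinite_dihedral (generated_subgroup [set` A])).
Proof.
move=> ti uP PA; case: P uP PA => [|p0 [|p1 P]] // uP PA _ Pcyc.
set P' := [:: p0, p1 & P] in PA Pcyc uP *.
have p0P : p0 \in P' by rewrite mem_head.
have p1P : p1 \in P' by rewrite !inE eqxx orbT.
have n01 : p1 * p0^-1 <> 1.
  by move/eqP; rewrite divg_eq1 => /eqP e; move: uP; rewrite /= e inE eqxx.
have [nA|/existsNP[y /not_implyP[yA ny]]] :=
    pselect (forall y, y \in A -> norm_cyc t (p0 * y)); last first.
  left; apply: (leq_square_triple_product uP PA yA) => p p' pP p'P q q' qP q'P e.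
  have [eqq|nqq] := pselect (q' * q^-1 = 1).
    by move/eqP: eqq; rewrite divg_eq1 => /eqP eqq; move: e; rewrite eqq => /mulIg/mulIg.
  have d1 : in_cyc t ((p' * p0^-1)^-1 * (p * p0^-1)).
    by apply: in_cycM; [apply: in_cycV|]; apply: Pcyc.
  (* A collision means that conjugation by the inverse of [p0 y] maps a nontrivial element of [C]
     into [C]. *)
  have ed : (q' * q^-1) ^ (p0 * y)^-1 = (p' * p0^-1)^-1 * (p * p0^-1).
    have -> : q' = (p' * y)^-1 * (p * y * q) by rewrite e mulKg.
    by rewrite conjgE invgK !invgM invgK !mulgA !mulgK.
  case: ny; rewrite -[p0 * y]invgK; apply: norm_cycV.
  by apply: (norm_cyc_conj ti nqq); [apply: Pcyc|rewrite ed].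
have n00 := nA _ (PA _ p0P); have n11 := nA _ (PA _ p1P).
pose c := p1 * p0^-1; have cc : in_cyc t c by apply: Pcyc.
have nc : norm_cyc t (c ^ p0^-1).
  have -> : c ^ p0^-1 = (p0 * p1) * (p0 * p0)^-1.
    by rewrite conjgE invgK /c !invgM !mulgA.
  by apply: norm_cycM => //; apply: norm_cycV.
(* The conjugate of [c] is only known to normalize [C], but its square lies in [C]; hence the use of
   [c c]. *)
have n0 : norm_cyc t p0.
  rewrite -[p0]invgK; apply: norm_cycV.
  apply: (norm_cyc_conj ti (c := c * c)).
  - by move/(in_cyc_square ti cc).
  - exact: in_cycM.
  - rewrite conjMg; exact: norm_cyc_square ti _ nc.
right; apply: (cyclic_or_dihedral ti (generated_is_subgroup _) (c := c)) => //.
- apply: generated_norm_cyc ti _ => y yA; rewrite -[y](mulKg p0).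
  by apply: norm_cycM; [apply: norm_cycV|apply: nA].
- have [_ GM GV] := generated_is_subgroup [set` A].
  by apply: GM; [|apply: GV]; apply: sub_gen_smallest; apply: PA.
Qed.
End TripleProducts.

(** * Malnormality of the factors *)

Section Factors.
Variables G H : groupType.
Notation letter := (G + H)%type.
Notation Gam := (free_product G H).
Local Open Scope group_scope.
Implicit Types (l s : letter) (w : seq letter) (d y c : Gam).

Definition side l := if l is inl _ then true else false.

(** [true] stands for [G] and [false] for [H]; the letter may be trivial, so both contain the
    identity. *)
Definition in_factor b d := exists2 l, side l = b & d = letter_word l.

Lemma same_factorE s l : same_factor s l = (side s == side l).
Proof. by case: s; case: l. Qed.

Lemma letter_wordE l : letter_word l = of_word [:: l].
Proof. exact/val_inj. Qed.

Lemma in_factorV b d : in_factor b d -> in_factor b d^-1.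
Proof.
case=> l sl ->; exists (inv_letter l); first by case: l sl.
rewrite !letter_wordE -of_word_inv //.
Qed.

Lemma in_factorM b d d' : in_factor b d -> in_factor b d' -> in_factor b (d * d').
Proof.
case=> l <- -> [l' sl' ->]; exists (letter_mul l l'); first by case: l sl'; case: l'.
by case: l sl' => x; case: l' => y // _; apply: esym; [apply: fp_inlM|apply: fp_inrM].
Qed.

(** For nontrivial [l] and [l'] the reduced words [l w] and [w l'] begin in different factors; for
    nontrivial [l] and trivial [l'] the lengths differ. *)
Lemma malnormal_core b w l l' : w != [::] -> reduced w ->
  side (head l w) != b -> side (last l w) != b -> side l = b -> side l' = b ->
  of_word [:: l] * of_word w = of_word w * of_word [:: l'] -> trivial_letter l.
Proof.
move=> w0 rw hw lw sl sl' e; apply: contraT => l1.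
have rlw : reduced (l :: w).
  rewrite reduced_cons l1 rw; case: (w) hw => //= s w' hs.
  by rewrite same_factorE sl eq_sym hs.
have e1 : of_word (l :: w) = of_word (w ++ [:: l']) by rewrite !of_word_cat -e -of_word_cat.
have [l'1|l'1] := boolP (trivial_letter l').
  have el' : of_word [:: l'] = 1 by apply/val_inj; rewrite /= /cons_reduce l'1.
  have := congr1 (@fp_word G H) e1; rewrite of_word_cat el' mulg1 !of_word_val //.
  by move/(congr1 size)/esym/n_Sn.
have rwl : reduced (w ++ [:: l']).
  case/lastP: (w) w0 rw lw => // w' s _ rw; rewrite last_rcons => ls.
  rewrite cat_rcons; apply: (reduced_glue rw); first by case: (s).
  have := @reduced_catr _ _ w' [:: s]; rewrite cats1 => /(_ rw)/reduced_head s1.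
  by rewrite !reduced_cons s1 /= l'1 same_factorE sl' ls.
have := congr1 (@fp_word G H) e1; rewrite !of_word_val //.
by case: (w) w0 hw => //= s w' _ hs [es _]; rewrite -es sl eqxx in hs.
Qed.

(** Write [y = e1 v e2], where [e1] and [e2] absorb the outer letters of factor [b], and move them
    into [d] and [d'] by conjugation; [v] is nonempty since [y] lies outside the factor. *)
Lemma factor_malnormal b y d d' : ~ in_factor b y -> in_factor b d -> in_factor b d' ->
  d * y = y * d' -> d = 1.
Proof.
move=> ny fd fd' e.
have f1 : in_factor b 1.
  exists (if b then inl 1 else inr 1); first by case: (b).
  by apply/val_inj; case: (b); rewrite /= /cons_reduce /= eqxx.
have FPE w (rw : reduced w) : FreeProduct rw = of_word w.
  by apply/val_inj; rewrite /= word_mul_nil.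
have [e1 [w [f_e1 ey rw hw]]] : exists e1 w,
    [/\ in_factor b e1, y = e1 * of_word w, reduced w & side (head (inl 1) w) != b \/ w = [::]].
  case: y ny e => [[|l w] rw] ny _.
    by exists 1, [::]; rewrite mul1g -FPE; split=> //; right.
  have [sl|sl] := eqVneq (side l) b; last first.
    by exists 1, (l :: w); rewrite mul1g -FPE; split=> //; left.
  exists (letter_word l), w; split; first by exists l.
  - by rewrite letter_wordE -of_word_cat FPE.
  - exact: reduced_tail rw.
  case: w rw {ny} => [|s w] rw; [by right|left]; move: rw; rewrite reduced_cons => /and3P[_ + _].
  by rewrite same_factorE sl eq_sym.
have w0 : w != [::].
  apply/eqP => w0; case: ny; rewrite ey w0 (_ : of_word [::] = 1) ?mulg1 //.
  exact/val_inj.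
have {}hw l : side (head l w) != b by case: hw => [|ew]; [case: (w) w0|rewrite ew in w0].
have [e2 [v [f_e2 ew rv [v0 hv lv]]]] : exists e2 v, [/\ in_factor b e2,
    of_word w = of_word v * e2, reduced v & [/\ v != [::], forall l, side (head l v) != b
    & forall l, side (last l v) != b]].
  case/lastP: w w0 rw hw {ey} => // w l _ rw hw.
  have [sl|sl] := eqVneq (side l) b; last first.
    exists 1, (rcons w l); rewrite mulg1; split=> //; split=> // [|l']; first by case: (w).
    by rewrite last_rcons.
  exists (letter_word l), w; split; first by exists l.
  - by rewrite letter_wordE -of_word_cat cats1.
  - by apply: (@reduced_catl _ _ _ [:: l]); rewrite cats1.
  have w0 : w != [::] by apply/eqP => w0; have := hw l; rewrite w0 /= sl eqxx.
  split=> // [l'|l']; first by have := hw l'; case: (w) w0.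
  case/lastP: w w0 rw {hw} => // w s _; rewrite last_rcons -!cats1 -catA => /reduced_catr.
  by rewrite reduced_cons => /and3P[_ + _] /=; rewrite same_factorE sl.
have [l sl el] : in_factor b (e1^-1 * d * e1).
  by do 2?apply: in_factorM => //; apply: in_factorV.
have [l' sl' el'] : in_factor b (e2 * d' * e2^-1).
  by do 2?apply: in_factorM => //; apply: in_factorV.
have l1 : trivial_letter l.
  apply: (malnormal_core v0 rv (hv l) (lv l) sl sl').
  rewrite -!letter_wordE -el -el'; apply: (@mulIg _ e2); apply: (@mulgI _ e1).
  have : d * (e1 * (of_word v * e2)) = e1 * (of_word v * e2) * d' by rewrite -ew -ey.
  by rewrite /= !mulgA mulgV mul1g mulgVK.
have l1' : letter_word l = 1 by apply/val_inj; rewrite /= /cons_reduce l1.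
have <- : e1 * (e1^-1 * d * e1) * e1^-1 = d by rewrite !mulgA mulgV mul1g mulgK.
by rewrite el l1' mulg1 mulgV.
Qed.

Lemma factor_dichotomy (A : {fset Gam}) (P : seq Gam) b c : uniq P -> {subset P <= A} ->
  {in P, forall p, in_factor b (c * p * c^-1)} ->
  (size P ^ 2 <= #|` triple_product A|)%N \/ {in A, forall a, in_factor b (c * a * c^-1)}.
Proof.
move=> uP PA fP; have [fA|nA] := pselect {in A, forall a, in_factor b (c * a * c^-1)}.
  by right.
left; have [y yA ny] : exists2 y, y \in A & ~ in_factor b (c * y * c^-1).
  by apply: contrapT => nex; apply: nA => a aA; apply: contrapT => na; apply: nex; exists a.
apply: (leq_square_triple_product uP PA yA) => p p' pP p'P q q' qP q'P e.
have cK z z' : (c * z * c^-1) * (c * z' * c^-1) = c * (z * z') * c^-1 by rewrite !mulgA mulgVK.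
have cV z : (c * z * c^-1)^-1 = c * z^-1 * c^-1 by rewrite !invgM invgK mulgA.
have : c * (p'^-1 * p) * c^-1 = 1.
  apply: (factor_malnormal (b := b) ny (d' := c * (q' * q^-1) * c^-1)).
  - by rewrite -cK -cV; apply: in_factorM; [apply: in_factorV|]; apply: fP.
  - by rewrite -cK -cV; apply: in_factorM; [|apply: in_factorV]; apply: fP.
  rewrite !cK; congr (_ * _ * _); apply: (@mulgI _ p'); apply: (@mulIg _ q).
  by rewrite !mulgA mulgVK mulgV mul1g e.
move/eqP; rewrite mulg_eq1 invgK => /eqP e1; apply/esym/eqP.
have : c * (p'^-1 * p) = c * 1 by rewrite e1 mulg1.
by move/mulgI/eqP; rewrite mulg_eq1 => /eqP/invg_inj->.
Qed.
End Factors.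

(** Take for [s] the value of [g] at some [u] with [f u = t]; if there is none, the bound is all of
    [U] and [l0] will do. *)
Lemma count_transfer (I K L : eqType) (l0 : L) (U : seq I) (f : I -> K) (g : I -> L) t :
  {in U &, forall u u', f u = f u' -> g u = g u'} ->
  exists s, count [pred u | g u != s] U <= count [pred u | f u != t] U.
Proof.
move=> fg; have [[u0 u0U fu0]|none] := pselect (exists2 u, u \in U & f u = t).
  exists (g u0).
  have -> : count [pred u | f u != t] U = count [pred u | (u \in U) && (f u != t)] U.
    by apply: eq_in_count => u /= ->.
  have -> : count [pred u | g u != g u0] U = count [pred u | (u \in U) && (g u != g u0)] U.
    by apply: eq_in_count => u /= ->.
  apply: sub_count => u /= /andP[uU]; rewrite uU; apply: contra => /eqP fu.
  by apply/eqP/fg => //; rewrite fu.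
exists l0; have -> : count [pred u | f u != t] U = size U; last exact: count_size.
apply/eqP; rewrite -all_count; apply/allP => u uU /=.
by apply/eqP => fu; apply: none; exists u.
Qed.

(** * Cutting a finite set of words *)

Section Splitting.
Variables (I L : eqType).
Implicit Types (O D Y : seq I) (f l : I -> L) (S : pred L).

Lemma count_linear O (a b c d e : pred I) :
  {in O, forall i, a i + b i + c i = 2 * d i + e i} ->
  count a O + count b O + count c O = 2 * count d O + count e O.
Proof.
elim: O => //= i O IHO h; have hi := h i (mem_head _ _).
have {}IHO := IHO (fun j jO => h j (mem_behead (s := i :: O) jO)).
by move: hi IHO; move: (a i) (b i) (c i) (d i) (e i) => [] [] [] [] []; lia.
Qed.

(* Greedy maximum cut: the letters are placed one by one, each on the better side. *)
Lemma symmetric_cut O f l (ls : seq L) : {in O, forall i, f i != l i} ->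
  exists S, count [pred i | (f i \in ls) && (l i \in ls)] O <=
    2 * count [pred i | [&& f i \in ls, l i \in ls & S (f i) != S (l i)]] O.
Proof.
move=> nfl; elim: ls => [|v ls [S IHS]].
  by exists xpred0; rewrite (eq_count (a2 := pred0)) ?count_pred0 // => i.
have [vls|vls] := boolP (v \in ls).
  exists S; have e z : (z \in v :: ls) = (z \in ls).
    by rewrite inE; case: eqVneq => [->|].
  rewrite (eq_count (a2 := [pred i | (f i \in ls) && (l i \in ls)])); last first.
    by move=> i /=; rewrite !e.
  apply: leq_trans IHS _; rewrite leq_mul2l /=; apply: sub_count => i /=.
  by rewrite !e.
pose Sb (b : bool) z := if z == v then b else S z.
pose cr (b : bool) := [pred i | [&& f i \in v :: ls, l i \in v :: ls & Sb b (f i) != Sb b (l i)]].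
have lin := @count_linear O (cr true) (cr false) [pred i | (f i \in ls) && (l i \in ls)]
  [pred i | [&& f i \in ls, l i \in ls & S (f i) != S (l i)]]
  [pred i | (f i \in v :: ls) && (l i \in v :: ls)].
(* A pair inside [ls] counts alike for both placements of [v]; a new pair has exactly one end equal
   to [v] and is cut by exactly one placement. *)
have /lin e : {in O, forall i, cr true i + cr false i + ((f i \in ls) && (l i \in ls)) =
    2 * [&& f i \in ls, l i \in ls & S (f i) != S (l i)] +
    ((f i \in v :: ls) && (l i \in v :: ls))}.
  move=> i /nfl; rewrite /= /Sb !inE.
  have [->|fv] := eqVneq (f i) v; have [->|lv] := eqVneq (l i) v;
    rewrite ?eqxx //= ?(negPf vls) //=.
  - by case: (l i \in ls); case: (S (l i)).
  - by case: (f i \in ls); case: (S (f i)).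
  by case: (f i \in ls); case: (l i \in ls); case: (S (f i)); case: (S (l i)).
have [le|le] := leqP (count (cr true) O) (count (cr false) O).
  by exists (Sb false); move: IHS e le; rewrite /cr; lia.
by exists (Sb true); move: IHS e le; rewrite /cr; lia.
Qed.

(** Half of the pairs are cut, and either [S] or its complement directs half of these the right
    way. *)
Lemma directed_cut O f l : {in O, forall i, f i != l i} ->
  exists S, size O <= 4 * count [pred i | S (f i) && ~~ S (l i)] O.
Proof.
move=> nfl; have [S] := symmetric_cut (map f O ++ map l O) nfl.
set ls := _ ++ _ => cS.
have inls i : i \in O -> (f i \in ls) && (l i \in ls).
  by move=> iO; rewrite !mem_cat !map_f ?orbT.
have e1 : count [pred i | (f i \in ls) && (l i \in ls)] O = size O.
  by apply/eqP; rewrite -all_count; apply/allP.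
pose c1 := [pred i | S (f i) && ~~ S (l i)]; pose c2 := [pred i | ~~ S (f i) && S (l i)].
have e2 : count [pred i | [&& f i \in ls, l i \in ls & S (f i) != S (l i)]] O <=
    count c1 O + count c2 O.
  rewrite -count_predUI; apply: leq_trans (leq_addr _ _); apply: sub_count => i /=.
  by case/and3P=> _ _; case: (S (f i)); case: (S (l i)).
have [le|le] := leqP (count c2 O) (count c1 O); first by exists S; rewrite -/c1; lia.
exists (predC S); have -> : count [pred i | predC S (f i) && ~~ predC S (l i)] O = count c2 O.
  by apply: eq_count => i /=; rewrite negbK.
by lia.
Qed.

(** In units of [n / 88]: a value with at least 8 units has at most 44 and leaves 10 of 54.
    Otherwise values are added one by one; the first total to reach 8 is below 16 and leaves 38. *)
Lemma balanced_partition D f n : 54 * n <= 88 * size D ->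
  (forall s, 88 * count [pred i | f i == s] D <= 44 * n) ->
  exists S, 8 * n <= 88 * count [pred i | S (f i)] D /\
            8 * n <= 88 * count [pred i | ~~ S (f i)] D.
Proof.
have [-> _ _|n0] := posnP n; first by exists xpred0.
move=> szD fib; have cntC S : count [pred i | S (f i)] D + count [pred i | ~~ S (f i)] D = size D.
  by rewrite -(count_predC [pred i | S (f i)] D).
have [[s big]|small] := pselect (exists s, 8 * n <= 88 * count [pred i | f i == s] D).
  by exists (pred1 s); have := cntC (pred1 s); have := fib s; rewrite /=; lia.
have {}small s : 88 * count [pred i | f i == s] D < 8 * n.
  by rewrite ltnNge; apply/negP => ?; apply: small; exists s.
have [[S hS]|] : (exists S, 8 * n <= 88 * count [pred i | S (f i)] D < 16 * n) \/
    88 * count [pred i | f i \in map f D] D < 8 * n.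
- elim: (map f D) => [|v ls [[S hS]|lt]].
  + by right; rewrite (eq_count (a2 := pred0)) ?count_pred0 // muln0 muln_gt0.
  + by left; exists S.
  have le : count [pred i | f i \in v :: ls] D <=
      count [pred i | f i == v] D + count [pred i | f i \in ls] D.
    rewrite -count_predUI; apply: leq_trans (leq_addr _ _).
    by apply: sub_count => i /=; rewrite inE.
  have := small v; have [lt'|ge] := ltnP (88 * count [pred i | f i \in v :: ls] D) (8 * n).
    by right.
  by left; exists (mem (v :: ls)); rewrite /= in le ge *; lia.
- by exists S; have := cntC S; lia.
have -> : count [pred i | f i \in map f D] D = size D.
  by apply/eqP; rewrite -all_count; apply/allP => i iD /=; rewrite map_f.
by lia.
Qed.

(** For the least [a] with 7 units of sizes up to [a], fewer than 7 of the 8 units have size below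
    [a], leaving 1. *)
Lemma size_threshold (sz : I -> nat) Y n : 8 * n <= 88 * size Y ->
  exists a, 7 * n <= 88 * count [pred i | sz i <= a] Y /\
            n <= 88 * count [pred i | a <= sz i] Y.
Proof.
move=> szY; pose P a := 7 * n <= 88 * count [pred i | sz i <= a] Y.
have exP : exists a, P a.
  exists (\max_(i <- Y) sz i); rewrite /P.
  have -> : count [pred i | sz i <= \max_(i <- Y) sz i] Y = size Y; last by lia.
  by apply/eqP; rewrite -all_count; apply/allP => i iY; rewrite /= leq_bigmax_seq.
have [a Pa amin] := ex_minnP exP; exists a; split=> //.
case: a Pa amin => [_ _|a _ amin].
  have -> : count [pred i | 0 <= sz i] Y = size Y; last by lia.
  by apply/eqP; rewrite -all_count; apply/allP.
have : ~~ P a by apply/negP => /amin; rewrite ltnn.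
rewrite -ltnNge; have := count_predC [pred i | sz i <= a] Y.
have -> : count (predC [pred i | sz i <= a]) Y = count [pred i | a < sz i] Y.
  by apply: eq_count => i /=; rewrite ltnNge.
by lia.
Qed.
End Splitting.

(** * Products without cancellation *)

Section Core.
Variables G H : groupType.
Notation letter := (G + H)%type.
Notation Gam := (free_product G H).
Implicit Types (s b c d : letter) (u v w x : seq letter) (U V X Z : seq (seq letter)).

Definition first_letter w : letter := head (inl 1%g) w.
Definition last_letter w : letter := last (inl 1%g) w.

Lemma letter_mul_injl b s s' : same_factor s b -> same_factor s' b ->
  letter_mul s b = letter_mul s' b -> s = s'.
Proof. by case: b => y; case: s => x; case: s' => x' //= _ _ [/mulIg->]. Qed.

Lemma letter_mul_injr c d d' : same_factor c d -> same_factor c d' ->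
  letter_mul c d = letter_mul c d' -> d = d'.
Proof. by case: c => y; case: d => x; case: d' => x' //= _ _ [/mulgI->]. Qed.

(* The last letter of [u] is multiplied by the first letter [b] of [x] if they merge. *)
Definition absorb_last b u :=
  if u is [::] then [::] else
  rcons (take (size u).-1 u)
    (if same_factor (last_letter u) b then letter_mul (last_letter u) b else last_letter u).

Definition absorb_first c v :=
  if v is d :: v' then (if same_factor c d then letter_mul c d else d) :: v' else [::].

Lemma absorb_last_rcons b u s :
  absorb_last b (rcons u s) = rcons u (if same_factor s b then letter_mul s b else s).
Proof.
have e : absorb_last b (rcons u s) = rcons (take (size (rcons u s)).-1 (rcons u s))
    (if same_factor (last_letter (rcons u s)) b then letter_mul (last_letter (rcons u s)) b
     else last_letter (rcons u s)) by case: (u).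
by rewrite e /last_letter last_rcons size_rcons -[in take _ _]cats1 take_size_cat.
Qed.

Lemma join_absorb s b :
  join s b = (if same_factor s b then letter_mul s b else s) ::
             (if same_factor s b then [::] else [:: b]).
Proof. by rewrite /join; case: ifP. Qed.

Lemma join_absorb_r c d :
  join c d = rcons (if same_factor c d then [::] else [:: c])
                   (if same_factor c d then letter_mul c d else d).
Proof. by rewrite /join; case: ifP. Qed.

Section Triple.
Variables (U V Z : seq (seq letter)) (i j : bool).
Hypotheses (uU : uniq U) (uV : uniq V).
Hypothesis Ur : {in U, forall u, [&& u != [::], reduced u & side (last_letter u) == i]}.
Hypothesis Vr : {in V, forall v, [&& v != [::], reduced v & side (first_letter v) == j]}.

Definition compatible x :=
  [/\ reduced x, 1 < size x,
   {in U, forall u, size u <= size x /\ inv_letter (last_letter u) != first_letter x},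
   {in V, forall v, size v <= size x /\ inv_letter (last_letter x) != first_letter v}
   & {in U & V, forall u v, word_mul u (word_mul x v) \in Z}].

Lemma compatible_mul x u v : compatible x -> u \in U -> v \in V ->
  exists u' s b x' c d v', [/\ u = rcons u' s, x = b :: rcons x' c, v = d :: v'
    & u' ++ (join s b ++ x' ++ join c d) ++ v' \in Z].
Proof.
move=> [rx sx xU xV xZ] uU' vV; have := xZ _ _ uU' vV.
have /and3P[u0 ru _] := Ur uU'; have /and3P[v0 rv _] := Vr vV.
have [_ nu] := xU _ uU'; have [_ nv] := xV _ vV.
case/lastP: u u0 ru nu {uU'} => // u' s _ ru nu.
case: v v0 rv nv {vV} => // d v' _ rv nv.
case: x rx sx nu nv {xU xV xZ} => // b x; case/lastP: x => // x' c rx _ nu nv.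
rewrite word_mul3_join //; last first.
- by move: nv; rewrite /last_letter /= last_rcons.
- by move: nu; rewrite /last_letter last_rcons.
by exists u', s, b, x', c, d, v'.
Qed.

(** As all [u] end in factor [i], either all or none merge with the first letter of [x], and
    likewise for [v]. Dropping the merging letters of [x] leaves [x0], around which the products are
    concatenations. *)
Lemma common_end_letters x : compatible x ->
  (exists s, count [pred u | last_letter u != s] U * size V <= 2 * size Z) /\
  (exists d, count [pred v | first_letter v != d] V * size U <= 2 * size Z).
Proof.
move=> cx; have [rx sx xU xV _] := cx.
pose b := first_letter x; pose c := last_letter x.
pose x2 := behead (take (size x).-1 x).
have ex : x = b :: rcons x2 c.
  rewrite /b /c /x2; case: (x) sx => // b' x'; case/lastP: x' => // x' c' _.
  by rewrite /last_letter /= last_rcons size_rcons /= -[in take _ _]cats1 take_size_cat.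
pose x0 := (if i == side b then [::] else [:: b]) ++ x2 ++ (if side c == j then [::] else [:: c]).
have szx0 : size x <= size x0 + 2.
  by rewrite /x0 {1}ex /= size_rcons !size_cat; lia.
pose U' := map (absorb_last b) U; pose V' := map (absorb_first c) V.
have inj_last : {in U &, injective (absorb_last b)}.
  move=> u u' /Ur/and3P[+ _ +] /Ur/and3P[+ _ +].
  case/lastP: u => // u s _; case/lastP: u' => // u' s' si _ s'i.
  rewrite !absorb_last_rcons; move: si s'i; rewrite /last_letter !last_rcons => /eqP si /eqP s'i.
  have se : same_factor s' b = same_factor s b by rewrite !same_factorE si s'i.
  move/rcons_inj => [->]; rewrite se; case: ifP => sb; last by move=> ->.
  by move/letter_mul_injl => ->; rewrite ?se.
have inj_first : {in V &, injective (absorb_first c)}.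
  move=> [|d v] [|d' v'] /Vr/and3P[//= _ _ dj] /Vr/and3P[//= _ _ dj'] [+ ->].
  have se : same_factor c d' = same_factor c d.
    by rewrite !same_factorE (eqP dj) (eqP dj').
  rewrite se; case: ifP => sb; last by move=> ->.
  by move/letter_mul_injr => ->; rewrite ?se.
have uU' : uniq U' by rewrite map_inj_in_uniq.
have uV' : uniq V' by rewrite map_inj_in_uniq.
have szl u : u \in U -> size (absorb_last b u) = size u.
  by move=> /Ur/and3P[]; case/lastP: u => // u s _ _ _; rewrite absorb_last_rcons !size_rcons.
have szf v : v \in V -> size (absorb_first c v) = size v.
  by move=> /Vr/and3P[]; case: v.
have inZ : {in U & V, forall u v, absorb_last b u ++ x0 ++ absorb_first c v \in Z}.
  move=> u v uU1 vV1; have [u1 [s [b1 [x1 [c1 [d [v1 [eu ex1 ev]]]]]]]] :=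
    compatible_mul cx uU1 vV1.
  move: ex1; rewrite ex => -[eb /rcons_inj[ex1 ec]]; rewrite -eb -ex1 -ec.
  have /and3P[_ _ /eqP si] := Ur uU1; have /and3P[_ _ /eqP dj] := Vr vV1.
  rewrite eu /last_letter last_rcons in si; rewrite ev /first_letter /= in dj.
  have -> : x0 = (if same_factor s b then [::] else [:: b]) ++ x2 ++
                 (if same_factor c d then [::] else [:: c]).
    by rewrite /x0 !same_factorE si dj.
  by rewrite eu ev absorb_last_rcons join_absorb join_absorb_r /= cat_rcons -!cats1 -!catA.
(* [x0] may be two letters shorter than [x]; starting the window at 1, as [u] is nonempty, makes up
   for it. *)
have szU : {in U', forall u, 1 <= size u <= 1 + (uphalf (size x0)).*2.+1}.
  move=> _ /mapP[u uU1 ->]; rewrite szl //; have [le _] := xU _ uU1.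
  by have /and3P[u0 _ _] := Ur uU1; rewrite lt0n size_eq0 u0 /=; lia.
have szV : {in map rev V', forall v, 1 <= size v <= 1 + (uphalf (size (rev x0))).*2.+1}.
  move=> _ /mapP[_ /mapP[v vV1 ->] ->]; rewrite !size_rev szf //; have [le _] := xV _ vV1.
  by have /and3P[v0 _ _] := Vr vV1; rewrite lt0n size_eq0 v0 /=; lia.
have UVZ : {in U' & V', forall u v, u ++ x0 ++ v \in Z}.
  by move=> _ _ /mapP[u uU1 ->] /mapP[v vV1 ->]; exact: inZ.
have VUZ : {in map rev V' & map rev U', forall v u, v ++ rev x0 ++ u \in map rev Z}.
  move=> _ _ /mapP[v vV1 ->] /mapP[u uU1 ->].
  by rewrite -!rev_cat -catA map_f // UVZ.
have uU'' : uniq (map rev U') by rewrite map_inj_uniq //; exact: inv_inj revK.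
have uV'' : uniq (map rev V') by rewrite map_inj_uniq //; exact: inv_inj revK.
split.
  have [t] := common_last_letter (inl 1%g) uU' uV' szU UVZ; rewrite count_map size_map => ct.
  have [|s cs] := @count_transfer _ _ _ (inl 1%g) U (last_letter \o absorb_last b) last_letter t.
    move=> u u' /Ur/and3P[+ _ +] /Ur/and3P[+ _ +] /=.
    case/lastP: u => // u s _; case/lastP: u' => // u' s' si _ s'i.
    rewrite !absorb_last_rcons; move: si s'i; rewrite /last_letter !last_rcons => /eqP si /eqP s'i.
    have se : same_factor s' b = same_factor s b by rewrite !same_factorE si s'i.
    rewrite se; case: ifP => sb //.
    by apply: letter_mul_injl; rewrite ?se.
  by exists s; apply: leq_trans ct; rewrite leq_mul2r cs orbT.
have [t] := common_last_letter (inl 1%g) uV'' uU'' szV VUZ.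
rewrite !count_map !size_map => ct.
have [|d cd] := @count_transfer _ _ _ (inl 1%g) V
    (last_letter \o (rev \o absorb_first c)) first_letter t.
  move=> [|d v] [|d' v'] /Vr/and3P[//= _ _ /eqP dj] /Vr/and3P[//= _ _ /eqP dj'].
  rewrite /last_letter !rev_cons !last_rcons.
  have se : same_factor c d' = same_factor c d by rewrite !same_factorE dj dj'.
  rewrite se; case: ifP => sb //.
  by apply: letter_mul_injr; rewrite ?se.
by exists d; apply: leq_trans ct; rewrite leq_mul2r cd orbT.
Qed.
End Triple.
End Core.

(** * From common periods to a coset of a cyclic group *)

Section Axis.
Variables G H : groupType.
Notation letter := (G + H)%type.
Notation Gam := (free_product G H).
Implicit Types (s b c d : letter) (u v w x : seq letter).
Local Open Scope group_scope.

Lemma of_word_join s b : of_word (join s b) = of_word [:: s] * of_word [:: b] :> Gam.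
Proof.
rewrite -of_word_cat /join; case: ifP => // sb.
rewrite (@of_word_cat G H [:: s] [:: b]) -!letter_wordE.
by case: s sb => x; case: b => y // _; [apply: fp_inlM|apply: fp_inrM].
Qed.

(** The word of [s x d] without cancellation, meaningful when [x] has at least two letters. *)
Definition flank s d x :=
  if x is b :: x' then join s b ++ take (size x').-1 x' ++ join (last b x') d else [::].

Lemma flankE s d b x c : flank s d (b :: rcons x c) = join s b ++ x ++ join c d.
Proof. by rewrite /flank last_rcons size_rcons -[in take _ _]cats1 take_size_cat. Qed.

Lemma of_word_flank s d x : (1 < size x)%N ->
  of_word (flank s d x) = of_word [:: s] * of_word x * of_word [:: d] :> Gam.
Proof.
case: x => // b x; case/lastP: x => // x c _.
have -> : of_word (b :: rcons x c) = of_word [:: b] * of_word x * of_word [:: c] :> Gam.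
  by rewrite -!of_word_cat -catA cats1.
by rewrite flankE !of_word_cat !of_word_join !mulgA.
Qed.

Lemma size_flank s d x : (1 < size x)%N -> (size x <= size (flank s d x))%N.
Proof.
case: x => // b x; case/lastP: x => // x c _; rewrite flankE /= size_rcons !size_cat.
by rewrite /join; do 2!case: ifP => _ /=; lia.
Qed.

Lemma compatible_axis (U V X Z : seq (seq letter)) i j s d x0 :
  uniq U -> uniq V ->
  {in U, forall u, [&& u != [::], reduced u & side (last_letter u) == i]} ->
  {in V, forall v, [&& v != [::], reduced v & side (first_letter v) == j]} ->
  {in U, forall u, last_letter u = s} -> {in V, forall v, first_letter v = d} ->
  x0 \in X -> {in X, forall x, compatible U V Z x} ->
  (8 * size Z < size U * size V)%N ->
  exists2 t : Gam, isolated t &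
    {in X &, forall x x', in_cyc t (of_word x' * (of_word x)^-1)}.
Proof.
move=> uU uV Ur Vr Us Vd x0X cX big.
pose chop (u : seq letter) := take (size u).-1 u.
have chopE u : u \in U -> u = rcons (chop u) s.
  move=> uU'; have := Us _ uU'; have /and3P[+ _ _] := Ur _ uU'.
  case/lastP: u {uU'} => // u s' _; rewrite /last_letter last_rcons => ->.
  by rewrite /chop size_rcons -[in take _ _]cats1 take_size_cat.
have beheadE v : v \in V -> v = d :: behead v.
  move=> vV; have := Vd _ vV; have /and3P[+ _ _] := Vr _ vV.
  by case: v {vV} => // d' v _; rewrite /first_letter /= => ->.
have leq_uphalf n : (n <= (uphalf n).*2.+1)%N by lia.
have uU' : uniq (map chop U).
  by rewrite map_inj_in_uniq // => u u' /chopE eu /chopE eu' e; rewrite eu eu' e.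
have uV' : uniq (map behead V).
  by rewrite map_inj_in_uniq // => v v' /beheadE ev /beheadE ev' e; rewrite ev ev' e.
have szX x : x \in X -> (size x <= size (flank s d x))%N /\ (1 < size x)%N.
  by case/cX=> _ sx _ _ _; split; rewrite ?size_flank.
have [||||||w [w' [w0 ww' [_ /mapP[u uU1 ->] wu]]]] :=
    @common_axis _ s (map chop U) (map behead V) (map (flank s d) X) Z (flank s d x0) uU' uV'.
- exact: map_f.
- by apply/mapP => -[x /szX[le lt] e]; rewrite -e /= in le; lia.
- move=> _ _ /mapP[u uU1 ->] /mapP[x xX ->]; have [le lt] := szX _ xX.
  have [_ _ /(_ _ uU1)[leu _] _ _] := cX _ xX.
  move: leu; rewrite {1}(chopE _ uU1) size_rcons => /ltnW/leq_trans/(_ le)/leq_trans; exact.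
- move=> _ _ /mapP[v vV1 ->] /mapP[x xX ->]; have [le lt] := szX _ xX.
  have [_ _ _ /(_ _ vV1)[lev _] _] := cX _ xX.
  move: lev; rewrite {1}(beheadE _ vV1) /= => /ltnW/leq_trans/(_ le)/leq_trans; exact.
- move=> _ _ _ /mapP[u uU1 ->] /mapP[x xX ->] /mapP[v vV1 ->].
  have [u' [s' [b [x' [c [d' [v' [eu ex ev inZ]]]]]]]] := compatible_mul Ur Vr (cX _ xX) uU1 vV1.
  move: (chopE _ uU1) (beheadE _ vV1) inZ; rewrite {1}eu {1}ev ex flankE.
  by move=> /rcons_inj[-> ->] [-> ->].
- by rewrite !size_map.
(* A reduced word of [U] contains the cube of [w]. *)
have rw : reduced (w ++ w).
  have /and3P[_ ru _] := Ur _ uU1; move: ru; rewrite {1}(chopE _ uU1) -cats1.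
  move/reduced_catl; case/suffixP: wu => p ->; rewrite /wpow /= cats0 => /reduced_catr.
  by rewrite catA => /reduced_catl.
have [t [k [ti k0 ewt]]] := isolated_root w0 rw.
(* The periods belong to [s x d]: in the quotients [d] cancels, and conjugating by [s] removes
   [s]. *)
exists (t ^ of_word [:: s]); first exact: isolated_conj.
move=> x x' xX x'X; pose y z := of_word [:: s] * of_word z * of_word [:: d].
have com z : z \in X -> t ^+ k * y z = y z * of_word w'.
  move=> zX; have := ww' _ (map_f (flank s d) zX).
  move/(congr1 (@of_word G H)); rewrite !of_word_cat of_word_flank ?(szX _ zX).2 //.
  by rewrite ewt.
have cyc : in_cyc t (y x' * (y x)^-1).
  case: ti => _; apply; first exact: k0.
  have e : (y x)^-1 * t ^+ k = of_word w' * (y x)^-1.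
    by apply: (@mulgI _ (y x)); rewrite mulVKg mulgA -com // mulgK.
  by rewrite /commute -[LHS]mulgA e mulgA -com // [RHS]mulgA.
case: cyc => m [n e]; exists m, n; rewrite -!conjXg -conjVg -conjMg -e /y.
by rewrite conjgE !invgM !mulgA mulVg mul1g mulgK mulgVK.
Qed.
End Axis.

Lemma majority (I : eqType) (p : I -> bool) (U : seq I) :
  exists i, size U <= 2 * size [seq u <- U | p u == i].
Proof.
have e : size [seq u <- U | p u == true] + size [seq u <- U | p u == false] = size U.
  rewrite !size_filter -(count_predC p); congr (_ + _); apply: eq_count => u /=.
    by rewrite eqb_id.
  by rewrite eqbF_neg.
have [le|le] := leqP (size [seq u <- U | p u == false]) (size [seq u <- U | p u == true]).
  by exists true; lia.
by exists false; lia.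
Qed.

(** [a b >= 49 n^2 / 176^2 > 12 T] because 49 times 7776 exceeds 12 times 30976; the two losses take
    at most [2 T] each. *)
Lemma large_product a b a1 b1 m T n :
  a1 <= a -> b1 <= b -> 7 * n <= 88 * m -> m <= 2 * a -> m <= 2 * b -> 6 ^ 5 * T < n ^ 2 ->
  (a - a1) * b <= 2 * T -> (b - b1) * a <= 2 * T -> 8 * T < a1 * b1.
Proof.
move=> le_a le_b hm ha hb hT h1 h2.
have hab : 49 * n ^ 2 <= 176 * 176 * (a * b).
  have ha' : 7 * n <= 176 * a by lia.
  have hb' : 7 * n <= 176 * b by lia.
  by have := leq_mul ha' hb'; rewrite mulnACA (mulnACA 176) (mulnn n); lia.
have hp : a * b <= (a - a1) * b + a1 * b1 + (b - b1) * a.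
  rewrite -{1}(subnK le_a) mulnDl -addnA leq_add2l -{1}(subnK le_b) mulnDr addnC leq_add2l.
  by rewrite mulnC leq_mul2l le_a orbT.
by lia.
Qed.

(** * Selection of short and long words *)

Section WordSets.
Variables G H : groupType.
Notation letter := (G + H)%type.
Notation Gam := (free_product G H).
Implicit Types (s : letter) (u v w x y z : seq letter).

(* [y * z] is free of cancellation iff [inv_last y != first_letter z]. *)
Definition inv_last w : letter := inv_letter (last_letter w).

(* With [n / 88] as the unit, every letter [s] accounts for at most 44 units of words
   [s .. s^-1]; either 32 units have [first_letter w != inv_last w], and a directed cut of
   the letters keeps a quarter of them, or 54 units have equality, and splitting the
   letters leaves 8 units on each side. *)
Lemma noncancelling_parts (W : seq (seq letter)) n : 86 * n < 88 * size W ->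
  (forall s, 2 * count [pred w | (first_letter w == s) && (inv_last w == s)] W <= n) ->
  exists P Q : pred (seq letter),
    [/\ forall y z, P y -> Q z -> inv_last y != first_letter z /\ inv_last z != first_letter y,
        8 * n <= 88 * size (filter P W) & 8 * n <= 88 * size (filter Q W)].
Proof.
move=> szW fib; pose O := [seq w <- W | first_letter w != inv_last w].
pose D := [seq w <- W | first_letter w == inv_last w].
have szOD : size O + size D = size W.
  by rewrite addnC !size_filter count_predC.
have [bigO|smallO] := leqP (32 * n) (88 * size O).
  have [|S cS] := @directed_cut _ _ O (@first_letter G H) inv_last.
    by move=> w; rewrite mem_filter => /andP[].
  pose P w := [&& S (first_letter w), ~~ S (inv_last w) & first_letter w != inv_last w].
  have szP : size (filter P W) = count [pred w | S (first_letter w) && ~~ S (inv_last w)] O.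
    rewrite count_filter size_filter; apply: eq_count => w /=.
    by rewrite /P andbA.
  have szP8 : 8 * n <= 88 * size (filter P W).
    by move: cS bigO; rewrite -szP; move: (size O) (size _) => p q; lia.
  exists P, P; split=> // y z /and3P[fy ly _] /and3P[fz lz _].
  by split; [apply: contraNneq ly => ->|apply: contraNneq lz => ->].
have [||S [c1 c2]] := @balanced_partition _ _ D (@first_letter G H) n.
- by move: szW smallO; rewrite -szOD; move: (size O) (size D) => p q; lia.
- move=> s; have le : count [pred w | first_letter w == s] D <=
      count [pred w | (first_letter w == s) && (inv_last w == s)] W.
    rewrite count_filter; apply: sub_count => w /= /andP[/eqP<-].
    by rewrite eq_sym eqxx.
  by move: le (fib s); move: (count _ D) (count _ W) => p q; lia.
pose P b w := (S (first_letter w) == b) && (first_letter w == inv_last w).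
exists (P true), (P false); split.
- move=> y z /andP[/eqP Sy /eqP ey] /andP[/eqP Sz /eqP ez]; rewrite -ey -ez.
  by split; apply/eqP => e; move: Sy Sz; rewrite e => ->.
- apply: leq_trans c1 _; rewrite leq_mul2l /= count_filter size_filter.
  by apply: sub_count => w /=; rewrite /P eqb_id.
apply: leq_trans c2 _; rewrite leq_mul2l /= count_filter size_filter.
by apply: sub_count => w /=; rewrite /P eqbF_neg.
Qed.

(* [U] and [V] consist of the short words of one part and [X] of the long words of the
   other. A first pass with a single [x], letting the letters that merge at the two
   junctions be absorbed by [u] and [v], shows that most words of [U] have the same last
   letter and most words of [V] the same first letter; moving these two letters into [x]
   makes all the products [u x v] plain concatenations. *)
Lemma axis_of_small_tripling (W Z : seq (seq letter)) :
  uniq W -> {in W, forall w, reduced w} ->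
  (forall u x v, u \in W -> x \in W -> v \in W -> word_mul u (word_mul x v) \in Z) ->
  88 * count [pred w | size w <= 1] W < 2 * size W ->
  (forall s, 2 * count [pred w | [&& 1 < size w, first_letter w == s & inv_last w == s]] W
               <= size W) ->
  6 ^ 5 * size Z < size W ^ 2 ->
  exists X, [/\ uniq X, {subset X <= W}, size W <= 88 * size X
    & exists2 t : Gam, isolated t &
        {in X &, forall x x', in_cyc t (of_word x' * (of_word x)^-1)%g}].
Proof.
move=> uW rW WZ short fib small; set n := size W in short fib small *.
pose W2 := [seq w <- W | 1 < size w].
have szW2 : size W2 + count [pred w | size w <= 1] W = n.
  by rewrite size_filter /n -(count_predC [pred w | 1 < size w] W);
     congr (_ + _); apply: eq_count => w /=; rewrite leqNgt.
(* Words of at most one letter take less than 2 of the 88 units, which leaves the required 86. *)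
have [||P [Q [PQ cP cQ]]] := @noncancelling_parts W2 n; first lia.
  by move=> s; rewrite count_filter; apply: leq_trans (fib s); rewrite leq_mul2l /=;
     apply: sub_count => w /= /andP[/andP[-> ->] ->].
have [a [aP aP']] := size_threshold size cP.
have [b [bQ bQ']] := size_threshold size cQ.
(* The conditions on [P] and [Q] are symmetric, so the short words may be taken from the part with
   the smaller threshold. *)
wlog le_ab : P Q a b PQ cP cQ aP aP' bQ bQ' / a <= b.
  move=> hw; have [le|/ltnW le] := leqP a b; first exact: (hw P Q a b).
  by apply: (hw Q P b a) => // y z Qy Pz; have [] := PQ _ _ Pz Qy.
pose U0 := [seq u <- filter P W2 | size u <= a].
pose X := [seq x <- filter Q W2 | b <= size x].
have szU0 : 7 * n <= 88 * size U0 by rewrite size_filter.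
have szX : n <= 88 * size X by rewrite size_filter.
have n0 : 0 < n by move: small; case: (n) => //; rewrite exp0n.
have XW : {subset X <= W} by move=> x; rewrite !mem_filter => /and3P[_ _ /andP[]].
have [i ci] := majority (fun u => side (last_letter u)) U0.
have [j cj] := majority (fun u => side (first_letter u)) U0.
set U := filter _ U0 in ci; set V := filter _ U0 in cj.
have U0P u : u \in U0 -> [/\ u \in W, 1 < size u, P u & size u <= a].
  by rewrite !mem_filter => /and3P[-> -> /andP[-> ->]].
have uU0 : uniq U0 by rewrite !filter_uniq.
have uU : uniq U by rewrite filter_uniq.
have uV : uniq V by rewrite filter_uniq.
have Ur : {in U, forall u, [&& u != [::], reduced u & side (last_letter u) == i]}.
  move=> u; rewrite mem_filter => /andP[-> /U0P[uW' su _ _]].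
  by rewrite (rW _ uW') -size_eq0 -lt0n (ltnW su).
have Vr : {in V, forall v, [&& v != [::], reduced v & side (first_letter v) == j]}.
  move=> v; rewrite mem_filter => /andP[-> /U0P[vW' sv _ _]].
  by rewrite (rW _ vW') -size_eq0 -lt0n (ltnW sv).
have cX x : x \in X -> compatible U V Z x.
  rewrite !mem_filter => /and3P[bx Qx /andP[sx xW]]; split=> //; first exact: rW.
  - move=> u; rewrite mem_filter => /andP[_ /U0P[uW' _ Pu ua]].
    by split; [lia|have [] := PQ _ _ Pu Qx].
  - move=> v; rewrite mem_filter => /andP[_ /U0P[vW' _ Pv va]].
    by split; [lia|have [] := PQ _ _ Pv Qx].
  move=> u v; rewrite mem_filter => /andP[_ /U0P[uW' _ _ _]].
  by rewrite mem_filter => /andP[_ /U0P[vW' _ _ _]]; exact: WZ.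
have [x0 x0X] : exists x0, x0 \in X.
  by case: (X) szX => [|x X' _]; [rewrite muln0 leqNgt n0|exists x; rewrite mem_head].
have [[s cs] [d cd]] := common_end_letters uU uV Ur Vr (cX _ x0X).
pose U1 := [seq u <- U | last_letter u == s]; pose V1 := [seq v <- V | first_letter v == d].
have szU1 : size U1 + count [pred u | last_letter u != s] U = size U.
  by rewrite size_filter count_predC.
have szV1 : size V1 + count [pred v | first_letter v != d] V = size V.
  by rewrite size_filter count_predC.
have big : 8 * size Z < size U1 * size V1.
  apply: (@large_product (size U) (size V) _ _ (size U0) (size Z) n) => //.
  - by rewrite -szU1 leq_addr.
  - by rewrite -szV1 leq_addr.
  - by rewrite -{1}szU1 addKn.
  - by rewrite -{1}szV1 addKn.
have subU1 : {subset U1 <= U} by move=> u; rewrite mem_filter => /andP[].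
have subV1 : {subset V1 <= V} by move=> v; rewrite mem_filter => /andP[].
exists X; split=> //; first by rewrite !filter_uniq.
apply: (@compatible_axis _ _ U1 V1 X Z i j s d x0) => //.
- exact: filter_uniq.
- exact: filter_uniq.
- by move=> u /subU1/Ur.
- by move=> v /subV1/Vr.
- by move=> u; rewrite mem_filter => /andP[/eqP].
- by move=> v; rewrite mem_filter => /andP[/eqP].
move=> x /cX[rx sx xU xV xZ]; split=> //.
- by move=> u /subU1/xU.
- by move=> v /subV1/xV.
by move=> u v /subU1 uU1 /subV1 vV1; apply: xZ.
Qed.
End WordSets.

(** * Minimal conjugates *)

Lemma leq_sum_count (I : Type) (r : seq I) (p : pred I) (f g : I -> nat) :
  (forall i, f i + 4 * p i <= g i + 2) ->
  \sum_(i <- r) f i + 4 * count p r <= \sum_(i <- r) g i + 2 * size r.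
Proof.
move=> fg; elim: r => [|i r IHr]; first by rewrite !big_nil.
by rewrite !big_cons /=; have := fg i; lia.
Qed.

Section MinimalConjugate.
Variables G H : groupType.
Notation letter := (G + H)%type.
Notation Gam := (free_product G H).
Implicit Types (s : letter) (u v w : seq letter) (c g a : Gam) (A : {fset Gam}).

Lemma size_cons_reduce s w : size (cons_reduce s w) <= (size w).+1.
Proof.
by rewrite /cons_reduce; case: ifP => // _; case: s => x; case: w => [|[y|y] w] //=;
   case: ifP => //= _; lia.
Qed.

Lemma size_word_mul u v : size (word_mul u v) <= size u + size v.
Proof.
by elim: u => //= s u IHu; apply: leq_trans (size_cons_reduce _ _) _; rewrite addSn ltnS.
Qed.

Lemma size_of_word w : size (fp_word (of_word w)) <= size w.
Proof. by apply: leq_trans (size_word_mul _ _) _; rewrite addn0. Qed.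

Definition conj_length A c := \sum_(a <- A) size (fp_word (c * a * c^-1)%g).

Lemma shortest_conjugate A : exists c, forall g, conj_length A c <= conj_length A g.
Proof.
pose P n := `[< exists c, conj_length A c = n >].
have exP : exists n, P n by exists (conj_length A 1%g); apply/asboolP; exists 1%g.
have [n /asboolP[c <-] nmin] := ex_minnP exP.
by exists c => g; apply: nmin; apply/asboolP; exists g.
Qed.

(** The coefficient 4 turns a growth by 2 into a drop by 2. The condition [1 < size a] excludes a
    single involution, whose only letter is both first and last. *)
Lemma size_conj_letter s a :
  size (fp_word (of_word [:: inv_letter s] * a * (of_word [:: inv_letter s])^-1)%g)
    + 4 * [&& 1 < size a, first_letter a == s & inv_last a == s] <= size a + 2.
Proof.
have general : size (fp_word (of_word [:: inv_letter s] * a * (of_word [:: inv_letter s])^-1)%g)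
    <= size a + 2.
  apply: leq_trans (size_word_mul _ _) _.
  have -> : size a + 2 = 1 + size a + 1 by lia.
  apply: leq_add.
    apply: leq_trans (size_word_mul _ _) _; rewrite -add1n leq_add2r.
    exact: size_of_word.
  by rewrite -of_word_inv; apply: size_of_word.
case: and3P => [[sa /eqP fa /eqP la]|_]; last by rewrite muln0 addn0.
have [w ea] : exists w, fp_word a = s :: rcons w (inv_letter s).
  move: sa fa la; case: (fp_word a) => // s' w; case/lastP: w => // w l _.
  rewrite /first_letter /inv_last /last_letter /= last_rcons => -> <-.
  by exists w; rewrite inv_letterK.
rewrite ea; have -> : a = (of_word [:: s] * of_word w * of_word [:: inv_letter s])%g.
  by rewrite -[LHS]of_wordK ea -!of_word_cat /= cats1.
have e1 : (of_word [:: inv_letter s] * of_word [:: s] = 1 :> Gam)%g.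
  by rewrite -[[:: inv_letter s]]/(word_inv [:: s]) of_word_inv mulVg.
rewrite !mulgA e1 mul1g mulgK; apply: leq_trans (leq_add (size_of_word w) (leqnn _)) _.
by rewrite /= size_rcons muln1 !addnS !addn0.
Qed.

(* Conjugating by [s^-1] shortens the words [s .. s^-1] by two letters and lengthens the
   others by at most two. *)
Lemma few_conjugate_words A c s : (forall g, conj_length A c <= conj_length A g) ->
  2 * count [pred w | [&& 1 < size w, first_letter w == s & inv_last w == s]]
        [seq fp_word (c * a * c^-1)%g | a <- A] <= #|` A|.
Proof.
move=> cmin; rewrite count_map; set p := preim _ _.
pose g := (of_word [:: inv_letter s] * c)%g.
have sumA := @leq_sum_count _ A p (fun a => size (fp_word (g * a * g^-1)%g))
  (fun a => size (fp_word (c * a * c^-1)%g)).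
have {}sumA : conj_length A g + 4 * count p A <= conj_length A c + 2 * #|` A|.
  apply: sumA => a; have := size_conj_letter s (c * a * c^-1)%g.
  by rewrite /g invgM !mulgA.
by have := cmin g; lia.
Qed.
End MinimalConjugate.

(** * Assembling the trichotomy *)

Lemma inv_mul_square_le (N a b : nat) : 0 < N -> a ^ 2 <= N * b ->
  (1 / N%:R * a%:R ^+ 2 <= b%:R :> rat)%R.
Proof.
move=> N0 ab; rewrite GRing.mul1r GRing.mulrC Num.Theory.ler_pdivrMr ?Num.Theory.ltr0n //.
by rewrite -GRing.natrX -GRing.natrM Num.Theory.ler_nat [(b * N)%N]mulnC.
Qed.

Lemma short_in_factor (G H : groupType) (a : free_product G H) :
  size (fp_word a) <= 1 -> in_factor true a \/ in_factor false a.
Proof.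
move=> sz; rewrite -[a]of_wordK; case: (fp_word a) sz => [|l [|l' w]] //= _.
  by left; exists (inl 1%g) => //; apply/val_inj; rewrite /= /cons_reduce /= eqxx.
by case: l => x; [left; exists (inl x)|right; exists (inr x)]; rewrite ?letter_wordE.
Qed.

Local Open Scope classical_set_scope.
Local Open Scope group_scope.

Theorem corollary2p12 (G H : groupType)
    (ntG : exists g : G, g <> 1) (ntH : exists h : H, h <> 1)
    (A : {fset free_product G H}) (A0 : A <> fset0) :
  [\/ exists c : free_product G H,
        [set c * a * c^-1 | a in [set` A]] `<=` range (@fp_inl G H) \/
        [set c * a * c^-1 | a in [set` A]] `<=` range (@fp_inr G H),
      (1 / 7776 * (#|` A|)%:R ^+ 2 <= (#|` triple_product A|)%:R :> rat)%R
    | infinite_cyclic (generated_subgroup [set` A]) \/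
      infinite_dihedral (generated_subgroup [set` A])].
Proof.
have [big|small] := leqP (#|` A| ^ 2)%N (6 ^ 5 * #|` triple_product A|)%N.
  apply: Or32; have -> : (7776 = (6 ^ 5)%:R :> rat)%R by congr (_%:R)%R; vm_compute.
  exact: inv_mul_square_le.
have square_bound (P : seq (free_product G H)) : (#|` A| <= 88 * size P)%N ->
    (size P ^ 2 <= #|` triple_product A|)%N -> False.
  move=> AP PT; move: small; rewrite ltnNge => /negP; apply.
  apply: leq_trans (leq_mul AP AP) _; rewrite mulnACA mulnn leq_mul //.
have leAT : (#|` A| <= #|` triple_product A|)%N.
  have [a aA] : exists a, a \in A by apply/fset0Pn/eqP.
  rewrite -(size_map (fun x => a * a * x) A); apply: uniq_leq_size.
    by rewrite map_inj_uniq ?fset_uniq //; exact: mulgI.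
  by move=> _ /mapP[x xA ->]; apply: mem_triple_product.
have [c cmin] := shortest_conjugate A.
pose W := [seq fp_word (c * a * c^-1) | a <- A].
pose Z := [seq fp_word (c * z * c^-1) | z <- triple_product A].
have W_inj : injective (fun a : free_product G H => fp_word (c * a * c^-1)).
  by move=> a a' /val_inj/mulIg/mulgI.
have uW : uniq W by rewrite map_inj_uniq ?fset_uniq.
have rW : {in W, forall w, reduced w} by move=> _ /mapP[a _ ->]; exact: fp_wordP.
have WZ u x v : u \in W -> x \in W -> v \in W -> word_mul u (word_mul x v) \in Z.
  move=> /mapP[a aA ->] /mapP[b bA ->] /mapP[d dA ->]; apply/mapP.
  exists (a * b * d); first exact: mem_triple_product.
  rewrite -[LHS]/(fp_word ((c * a * c^-1) * ((c * b * c^-1) * (c * d * c^-1)))).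
  by congr fp_word; rewrite !mulgA !mulgVK.
pose F b := [seq a <- A | `[< in_factor b (c * a * c^-1) >]].
have uF b : uniq (F b) by rewrite filter_uniq ?fset_uniq.
have FA b : {subset F b <= A} by move=> a; rewrite mem_filter => /andP[].
have fF b : {in F b, forall a, in_factor b (c * a * c^-1)}.
  by move=> a; rewrite mem_filter => /andP[/asboolP].
have [largeF|smallF] := pselect (exists b, #|` A| <= 88 * size (F b))%N.
  have [b szF] := largeF; apply: Or31; exists c.
  have [/square_bound[]//|inF] := factor_dichotomy (uF b) (FA b) (fF b).
  by case: b inF {szF} => inF; [left|right] => _ [a /inF[[x|x] // _ ->] <-]; exists x.
(* A word of at most one letter lies in a factor, and each factor holds less than one unit. *)
have shortW : (88 * count [pred w : seq (G + H) | size w <= 1] W < 2 * size W)%N.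
  have le b : (88 * size (F b) < #|` A|)%N.
    by rewrite ltnNge; apply/negP => ?; apply: smallF; exists b.
  have : (count [pred w : seq (G + H) | size w <= 1] W <= size (F true) + size (F false))%N.
    rewrite !size_filter -count_predUI count_map; apply: leq_trans (leq_addr _ _).
    by apply: sub_count => a /short_in_factor[fa|fa]; apply/orP; [left|right]; apply/asboolP.
  have arith p q k m : (k <= p + q -> 88 * p < m -> 88 * q < m -> 88 * k < 2 * m)%N by lia.
  by rewrite size_map => /arith; apply; apply: le.
have [X [uX XW szX [t ti Xt]]] : exists X, [/\ uniq X, {subset X <= W}, (size W <= 88 * size X)%N
    & exists2 t : free_product G H, isolated t &
        {in X &, forall x x', in_cyc t (of_word x' * (of_word x)^-1)}].
  apply: (axis_of_small_tripling uW rW WZ shortW); last by rewrite !size_map.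
  by move=> s; rewrite size_map; apply: few_conjugate_words.
pose P := [seq a <- A | fp_word (c * a * c^-1) \in X].
have szP : (#|` A| <= 88 * size P)%N.
  rewrite -(size_map (fun a => fp_word (c * a * c^-1)) A); apply: leq_trans szX _.
  rewrite leq_mul2l -(size_map (fun a => fp_word (c * a * c^-1)) P) uniq_leq_size //.
  move=> x xX; have /mapP[a aA ex] := XW _ xX; apply/mapP; exists a => //.
  by rewrite mem_filter aA -ex xX.
apply: Or33; have [/square_bound[]//|//] :
    (size P ^ 2 <= #|` triple_product A|)%N \/
    (infinite_cyclic (generated_subgroup [set` A]) \/
     infinite_dihedral (generated_subgroup [set` A])).
apply: (@axis_dichotomy _ A P (t ^ c)) => //.
- exact: isolated_conj.
- by rewrite filter_uniq ?fset_uniq.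
- by move=> a; rewrite mem_filter => /andP[].
(* A set [P] with at most one element would give [|A| <= 88], and then [|A| <= |A^3|] already
   contradicts [small]. *)
- rewrite ltnNge; apply/negP => P1.
  have A88 : (#|` A| <= 88)%N by apply: leq_trans szP _; rewrite -{2}[88]muln1 leq_mul2l.
  move: small; rewrite ltnNge => /negP; apply.
  by apply: leq_mul; [exact: leq_trans A88 _|exact: leAT].
move=> p q; rewrite !mem_filter => /andP[pX _] /andP[qX _].
have := Xt _ _ pX qX; rewrite !of_wordK => -[m [n e]]; exists m, n.
rewrite -!conjXg -conjVg -conjMg -e conjgE !invgM invgK !mulgA.
by rewrite mulVg mul1g mulgVK mulgVK.
Qed.
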